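(* Let $Z=(X,Y)'$ be a random variable in $\mathbb{R}^2$ with finite second moment, $\mathbb{E}[Z]=0\in\mathbb{R}^2$, and $\mathrm{Var}(Y)=\sigma^2>0$ (with $\sigma>0$). Let $Z_1,Z_2,\dots$ be independent copies of $Z$, $\bar Z_n:=\frac1n\sum_{i=1}^nZ_i$. For a function $f$ as specified below, let $B,g,r,q,\mathcal{Q},\Pi_{\mathcal{Q}}$ be constructed from $f$ as in the context, let $(m_{n,1},m_{n,2})':=m_n:=\Pi_{\mathcal{Q}}(\bar Z_n)$ and let $t_n\in[-B,B]$ be such that $m_n=q(t_n)$. Let $\Phi$ be the standard normal distribution function. (i) Let $f(y)=y^\gamma$ with $\gamma>0$. Then $r(t)=1+\frac{\gamma}{1+\gamma}t^{\frac{1+\gamma}{\gamma}}$ for $t\in[0,B]$, and $n^{\gamma/2}t_n\to T$ in distribution as $n\to\infty$, where $\mathbb{P}(T\le s)=\Phi\Big(\frac{\operatorname{sgn}(s)|s|^{1/\gamma}}{\sigma}\Big)$ for all $s\in\mathbb{R}$. (ii) Let $f(y)=(-\log y)^{-\gamma}$ with $\gamma>0$. Then $r(t)=1+\int_0^t\exp\big(-x^{-1/\gamma}\big)\,\mathrm{d}x$ for $t\in[0,B]$, and $\big(\tfrac12\log n\big)^\gamma t_n\to T$ in distribution as $n\to\infty$, where $\mathbb{P}(T=1)=\mathbb{P}(T=-1)=\tfrac12$. (iii) Let $f(y)=\exp(-y^{-\gamma})$ with $\gamma>0$. Then $r(t)=1+\int_0^t\big(\log(x^{-1})\big)^{-1/\gamma}\,\mathrm{d}x$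 for $t\in[0,B]$. For $c>0$ define $U_{n,c}:=\exp\big((\sqrt n/c)^\gamma\big)\,t_n$ and $p_c:=\Phi(c/\sigma)$. Then, for all $u\in(0,\infty)$, as $n\to\infty$, $$\mathbb{P}(U_{n,c}\ge u)\to1-p_c,\qquad\mathbb{P}(U_{n,c}\le-u)\to1-p_c,\qquad\mathbb{P}(|U_{n,c}|\le u)\to2p_c-1.$$ All of these convergence results also hold when $t_n$ is replaced by $m_{n,2}$.
   Context: Construction of $\mathcal{Q}=\mathcal{Q}_f$: Let $b>0$ and let $f\colon[0,b]\to\mathbb{R}$ be continuous and strictly increasing with $f(0)=0$. Set $B:=f(b)$ and let $g:=f^{-1}\colon[0,B]\to[0,b]$ be the inverse function. For $t\in[0,B]$ put $r(t):=1+\int_0^tg(x)\,\mathrm{d}x$. For $t\in[-B,B]$ put $q(t):=r(|t|)\,(\cos t,\sin t)'$, and let $\mathcal{Q}:=\{q(t):t\in[-B,B]\}\subset\mathbb{R}^2$, which is compact. The prime on a vector denotes transposition and $\Vert\cdot\Vert$ is the Euclidean norm. In (i), (ii), (iii) the given formula defines $f$ on $(0,b]$, with $f(0):=0$; here $b>0$ is arbitrary in (i) and (iii), and $0<b<1$ in (ii). Projection: for $z\in\mathbb{R}^2$, $\Pi_{\mathcal{Q}}(z)$ denotes an element of $\operatorname{arg\,min}_{p\in\mathcal{Q}}\Vert z-p\Vert$ (nonempty by compactness); if the minimizer is not unique, one element of the argmin set is chosen by a fixed arbitrary mechanism, e.g. smallest in lexicographic order. The quantities $m_n$ and $t_n$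 are regarded as random variables (measurable). *)

(* Defs.v *)
From HB Require Import structures.
From mathcomp Require Import all_boot all_order all_algebra finmap.
From mathcomp Require Import all_classical all_reals all_analysis.

Set Implicit Arguments.
Unset Strict Implicit.
Unset Printing Implicit Defensive.

Import Order.TTheory GRing.Theory Num.Theory.
Import numFieldNormedType.Exports.

Local Open Scope classical_set_scope.
Local Open Scope ring_scope.

Section curve.
Context {R : realType}.
Implicit Types (b t : R) (f : R -> R) (z : R * R) (A : set (R * R)).

(* The canonical norm of [R * R] is the max norm. *)
Definition enorm z : R := Num.sqrt (z.1 ^+ 2 + z.2 ^+ 2).

Definition argmin_dist A z : set (R * R) :=
  [set p | A p /\ forall p', A p' -> enorm (z - p) <= enorm (z - p')].

(* Any selection rule is allowed where the minimizer is not unique. *)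
Definition is_projection A (Pi : R * R -> R * R) : Prop :=
  forall z, argmin_dist A z (Pi z).

(* The constructions below are meant for [0 < b] and [f] continuous and
   strictly increasing on [0, b] with [f 0 = 0]; the values of [f] outside
   [0, b] are irrelevant. *)

Definition curve_inv b f : R -> R := 'pinv_(fun=> 0) `[0, b] f.

(* Used for [t] in [0, f b] only. *)
Definition curve_radius b f t : R :=
  1 + \int[lebesgue_measure]_(x in `[0, t]) curve_inv b f x.

Definition curve_point b f t : R * R :=
  (curve_radius b f `|t| * cos t, curve_radius b f `|t| * sin t).

Definition curve b f : set (R * R) := curve_point b f @` `[- f b, f b].

Definition zero_at0 f : R -> R := fun y => if 0 < y then f y else 0.

Definition Phi (x : R) : R := fine (normal_prob 0 1 `]-oo, x]).

End curve.

Section random.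
Context {R : realType} {d : measure_display} {T : measurableType d}.
Context (P : probability T R).

Definition mutually_independent {d'} {S : measurableType d'} {I : choiceType}
    (Z : I -> {RV P >-> S}) : Prop :=
  forall (J : {fset I}) (A : I -> set S), (forall i, measurable (A i)) ->
    (P (\bigcap_(i in [set` J]) Z i @^-1` A i) =
     \prod_(i <- enum_fset J) P (Z i @^-1` A i))%E.

Definition iid_copies {d'} {S : measurableType d'} {I : choiceType}
    (Z : {RV P >-> S}) (Zs : I -> {RV P >-> S}) : Prop :=
  mutually_independent Zs /\
  forall i (A : set S), measurable A ->
    distribution P (Zs i) A = distribution P Z A.

(* [Zs i] is the (i+1)-st observation. *)
Definition sample_mean (Zs : nat -> T -> R * R) (n : nat) (w : T) : R * R :=
  (n%:R^-1 * (\sum_(i < n) (Zs i w).1), n%:R^-1 * (\sum_(i < n) (Zs i w).2)).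

Definition projected_means (Zs : nat -> T -> R * R) (b : R) (f : R -> R)
    (m : nat -> T -> R * R) (t : nat -> T -> R) : Prop :=
  exists2 Pi, is_projection (curve b f) Pi &
    forall n w, (0 < n)%N ->
      [/\ m n w = Pi (sample_mean Zs n w),
          t n w \in `[- f b, f b] &
          m n w = curve_point b f (t n w)].

(* Convergence of the distribution functions at the continuity points of the
   limiting one; the limit may live on another probability space. *)
Definition cvg_in_distribution {d'} {T' : measurableType d'}
    {P' : probability T' R} (V : nat -> T -> R) (W : {RV P' >-> R}) : Prop :=
  forall s : R, {for s, continuous (cdf W)} ->
    P [set w | V n w <= s] @[n --> \oo] --> cdf W s.

End random.

(* Main.v *)
Require Import Defs.
From HB Require Import structures.
From mathcomp Require Import all_boot all_order all_algebra finmap.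
From mathcomp Require Import all_classical all_reals all_analysis.
From mathcomp Require Import measurable_realfun.
From mathcomp Require Import ring lra.

Set Implicit Arguments.
Unset Strict Implicit.
Unset Printing Implicit Defensive.

Import Order.TTheory GRing.Theory Num.Theory.
Import numFieldNormedType.Exports.

Local Open Scope classical_set_scope.
Local Open Scope ring_scope.

(** The derivative of the squared distance from [(x, y)] to [q t] is, near the
    tip [q 0 = (1, 0)] of the curve and for [(x, y)] near the origin, about twice
    [sg t * g `|t| - y + x * t]: the growth of the radius is balanced against
    the gain from turning towards [(x, y)]. So the nearest point has a parameter
    with [g `|t|] close to [`|y|] and with the sign of [y]. The mean ordinate
    is [sigma / Num.sqrt n%:R] times a variable that is asymptotically standard
    normal, hence for [u > 0] the event [a n * t_n > u] is essentially the event
    that this variable exceeds [Num.sqrt n%:R * g (u / a n) / sigma]. Every limit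
    of the theorem is read off from the scaled slope
    [Num.sqrt n%:R * g (u / a n)]: it is the constant [u `^ gamma^-1] for a power
    [f], it tends to 0 or to infinity according to the position of [u] with
    respect to 1 for a power of a logarithm, and it tends to [c] for every [u]
    for the exponential of a power ([power_slope], [logarithmic_slope],
    [exponential_slope]).

    The balance is made precise without derivatives. The nearest parameter is
    first confined to a neighbourhood of 0 ([nearest_small]), and then compared
    with one fixed parameter [s]: [nearest_lt] and [nearest_gt] bound [y] from
    above and from below by [g s] up to small terms, using only that the
    increments of the radius lie between the values of [g] at the end points.
    With [s = u / a n] this gives the upper tail ([tail_cvg]); the lower one
    follows by reflection in the horizontal axis ([projected_tail]). At its tip
    the curve is vertical with unit speed, so the ordinate of the projection is
    equivalent to its parameter ([curve_point_ordinate]) and has the same tails.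

    The central limit theorem is proved by the exchange method of Lindeberg,
    with the explicit solution [heat a v x] of the heat equation as test
    function: replacing one summand by an increase of the time [v] by its
    variance changes the expectation by a term of higher order ([heat_step]),
    and after [n] exchanges only a Gaussian probability is left
    ([lindeberg_cvg]). Since [heat] at small times is close to the indicator of a
    half-line ([heat_sandwich]), distribution functions converge
    ([central_limit]). *)

(** * The standard normal distribution function *)

Definition rv_of {R : realType} {d d'} {T : measurableType d}
    {T' : measurableType d'} (P : probability T R) (f : T -> T')
    (mf : measurable_fun setT f) : {RV P >-> T'} := mfun_Sub (mem_set mf).

Section normal_cdf.
Context {R : realType}.
Implicit Types x y w h : R.

Local Notation phi := (normal_pdf (0 : R) 1).
Local Notation mu := (@lebesgue_measure R).

Lemma std_normal_pdfE w : phi w = normal_peak 1 * expR (- (w ^+ 2 / 2)).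
Proof.
rewrite normal_pdfE ?oner_neq0//= /normal_fun; congr (_ * expR _).
by rewrite subr0 expr1n mulNr.
Qed.

Lemma is_derive_Phi x : is_derive x 1 (@Phi R) (phi x).
Proof.
have xx1 : x < x + 1 by rewrite ltrDl.
have iphi : mu.-integrable [set` Interval -oo%O (BRight (x + 1))] (EFin \o phi).
  by apply: (integrableS measurableT) (integrable_normal_pdf 0 1).
have cphi : {for x, continuous phi}.
  by apply: continuous_normal_pdf; rewrite oner_neq0.
have [|D D1] := continuous_FTC1 xx1 iphi _ cphi; first exact: ltNyr.
apply: DeriveDef; first exact: D.
by rewrite -D1 derive1E.
Qed.

Lemma Phi_continuous : continuous (@Phi R).
Proof.
move=> x; apply/differentiable_continuous/derivable1_diffP.
by have [] := is_derive_Phi x.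
Qed.

Lemma PhiE x : normal_prob 0 1 `]-oo, x] = (Phi x)%:E.
Proof. by rewrite /Phi fineK// fin_num_measure. Qed.

Lemma Phi_ge0 x : 0 <= Phi x.
Proof. by rewrite -lee_fin -PhiE. Qed.

Lemma Phi_le1 x : Phi x <= 1.
Proof. by rewrite -lee_fin -PhiE; exact: probability_le1. Qed.

Lemma Phi_ler : {homo (@Phi R) : x y / x <= y}.
Proof.
move=> x y xy; rewrite -lee_fin -!PhiE; apply: le_measure; rewrite ?inE//.
exact: subset_itvl.
Qed.

Let measurable_idR :
  measurable_fun [set: measurableTypeR R] (idfun : measurableTypeR R -> R).
Proof. exact: measurable_id. Qed.

Let idn : {RV (normal_prob (0 : R) 1) >-> R} :=
  @rv_of R _ _ (measurableTypeR R) R _ _ measurable_idR.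

Lemma Phi_cvgy : Phi x @[x --> +oo] --> (1 : R).
Proof. by have /fine_cvgP[_] := cvg_cdfy1 idn; apply. Qed.

Lemma Phi_cvgNy : Phi x @[x --> -oo] --> (0 : R).
Proof. by have /fine_cvgP[_] := cvg_cdfNy0 idn; apply. Qed.

(** The density is even, so [Phi x + Phi (- x)] has zero derivative; its
    constant value is read off at infinity. *)
Lemma PhiN x : Phi (- x) = 1 - Phi x.
Proof.
pose F y : R := Phi y + Phi (- y).
have dF y : is_derive y 1 F 0.
  have dN : is_derive y 1 (@Phi R \o (fun y => - y)) (- phi y).
    have D : is_derive y 1 (fun y : R => - y) (- 1) by apply: is_deriveN.
    have := is_derive1_comp (is_derive_Phi (- y)) D.
    by rewrite mulrN1 !std_normal_pdfE sqrrN; exact.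
  rewrite -(subrr (phi y)).
  by apply: is_deriveD => //; exact: is_derive_Phi.
have Fc y : F y = F x by apply: is_derive_0_is_cst.
have PNy : Phi (- y) @[y --> +oo] --> (0 : R).
  by have := Phi_cvgNy; rewrite cvgNy_compNP.
have : F y @[y --> +oo] --> (1 + 0 : R) by apply: cvgD PNy; exact: Phi_cvgy.
rewrite addr0 (_ : F = cst (F x)); last exact/funext.
move/(cvg_lim (@Rhausdorff R)); rewrite lim_cst; last exact: Rhausdorff.
by rewrite /F => <-; rewrite addrC addKr.
Qed.

Lemma Phi0 : Phi 0 = 1 / 2 :> R.
Proof. by have := PhiN 0; rewrite oppr0; lra. Qed.

End normal_cdf.

(** * Taylor estimates for the Gaussian solution of the heat equation *)

Section taylor.
Context {R : realType}.
Implicit Types (f F : R -> R) (a b x w h C M : R).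

Lemma mean_value_bound f df a b C :
  (forall x, is_derive x 1 f (df x)) ->
  (forall x, `|x - a| <= `|b - a| -> `|df x| <= C) ->
  `|f b - f a| <= C * `|b - a|.
Proof.
move=> fdf dfC.
have cf x : {for x, continuous f}.
  by apply/differentiable_continuous/derivable1_diffP; have [] := fdf x.
have [ab|/ltW ba] := leP a b.
- have [|c cab ->] := MVT_segment ab (fun x _ => fdf x).
    by apply: continuous_subspaceT => x; exact: cf.
  rewrite normrM ler_wpM2r// dfC//; move: cab; rewrite in_itv/= => /andP[ac cb].
  by rewrite !ger0_norm ?subr_ge0// lerD2r.
- have [|c cab] := MVT_segment ba (fun x _ => fdf x).
    by apply: continuous_subspaceT => x; exact: cf.
  rewrite distrC => ->; rewrite normrM distrC ler_wpM2r// dfC//.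
  move: cab; rewrite in_itv/= => /andP[bc ca].
  by rewrite distrC [leRHS]distrC !ger0_norm ?subr_ge0// lerB.
Qed.

(** The remainder is the increment over [h] of [F] minus its tangent at [w],
    whose derivative is in turn an increment of [F1]. *)
Lemma taylor1_bound F F1 F2 w h M :
  (forall x, is_derive x 1 F (F1 x)) -> (forall x, is_derive x 1 F1 (F2 x)) ->
  (forall x, `|x - w| <= `|h| -> `|F2 x| <= M) ->
  `|F (w + h) - F w - h * F1 w| <= M * h ^+ 2.
Proof.
move=> FF1 F1F2 F2M.
pose G x := F x - x * F1 w.
have dG x : is_derive x 1 G (F1 x - F1 w).
  by have D := FF1 x; apply: is_derive_eq; rewrite /GRing.scale/=; ring.
have GE : F (w + h) - F w - h * F1 w = G (w + h) - G w by rewrite /G; ring.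
have hE : w + h - w = h by rewrite addrC addKr.
have := @mean_value_bound G _ w (w + h) (M * `|h|) dG.
rewrite GE hE -[h ^+ 2]real_normK ?num_real// expr2 mulrA; apply => x xh.
have := @mean_value_bound F1 F2 w x M F1F2.
move=> /(_ _)/le_trans; apply.
- by move=> y /le_trans/(_ xh); exact: F2M.
- apply: ler_wpM2l => //; apply: le_trans (F2M w _) => //.
  by rewrite subrr normr0.
Qed.

(** Apply [taylor1_bound] to [F] minus its quadratic term at [w]. *)
Lemma taylor2_bound F F1 F2 w h M :
  (forall x, is_derive x 1 F (F1 x)) -> (forall x, is_derive x 1 F1 (F2 x)) ->
  (forall x, `|x - w| <= `|h| -> `|F2 x - F2 w| <= M) ->
  `|F (w + h) - F w - h * F1 w - h ^+ 2 / 2 * F2 w| <= M * h ^+ 2.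
Proof.
move=> FF1 F1F2 F2M.
pose G x := F x - (x - w) ^+ 2 / 2 * F2 w.
pose G1 x := F1 x - (x - w) * F2 w.
have dG x : is_derive x 1 G (G1 x).
  by have D := FF1 x; apply: is_derive_eq; rewrite /GRing.scale /G1/=; field.
have dG1 x : is_derive x 1 G1 (F2 x - F2 w).
  by have D := F1F2 x; apply: is_derive_eq; rewrite /GRing.scale/=; ring.
have -> : F (w + h) - F w - h * F1 w - h ^+ 2 / 2 * F2 w =
    G (w + h) - G w - h * G1 w by rewrite /G /G1; ring.
exact: (taylor1_bound dG dG1).
Qed.

End taylor.

Section heat_kernel.
Context {R : realType}.
Implicit Types (a x w h v d e K : R).

Local Notation phi := (normal_pdf (0 : R) 1).

Lemma is_derive_std_normal_pdf x : is_derive x 1 phi (- (x * phi x)).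
Proof.
have -> : phi = (fun w => normal_peak 1 * expR (- (w ^+ 2 / 2))).
  by apply/funext => w; exact: std_normal_pdfE.
apply: is_derive_eq; rewrite /GRing.scale/=; by field.
Qed.

Lemma is_derive_std_normal_pdf2 x :
  is_derive x 1 (fun w => - (w * phi w)) ((x ^+ 2 - 1) * phi x).
Proof.
have D := is_derive_std_normal_pdf x.
by apply: is_derive_eq; rewrite /GRing.scale/=; ring.
Qed.

(** With [s := `|w| / 2] the density is a multiple of [expR (- s ^+ 2) ^+ 2],
    and [(1 + s ^+ 2) * expR (- s ^+ 2) <= 1] absorbs all the polynomials. *)
Lemma std_normal_pdf_decay : exists2 K, 0 < K &
  forall w, [/\ phi w <= K, `|w * phi w| <= K, `|(w ^+ 2 - 1) * phi w| <= K &
    `|w| ^+ 3 * phi w <= K].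
Proof.
have p0 : 0 < normal_peak 1 :> R by rewrite normal_peak_gt0// oner_neq0.
exists (8 * normal_peak 1) => [|w]; first by rewrite mulr_gt0.
set p := normal_peak 1 in p0 *.
pose s := `|w| / 2; pose E := expR (- s ^+ 2) ^+ 2.
have s0 : 0 <= s by rewrite divr_ge0.
have phiE : phi w = p * E.
  rewrite std_normal_pdfE /E -expRM_natl; congr (_ * expR _).
  by rewrite /s -[w ^+ 2]real_normK ?num_real//; field.
have E0 : 0 <= E by rewrite sqr_ge0.
have E1 : (1 + s ^+ 2) ^+ 2 * E <= 1.
  rewrite /E -exprMn expRN -[leRHS](expr1n _ 2) lerXn2r ?nnegrE ?mulr_ge0 ?addr_ge0
    ?sqr_ge0 ?invr_ge0 ?expR_ge0//.
  by rewrite ler_pdivrMr ?expR_gt0// mul1r expR_ge1Dx.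
have bound q : q <= 8 * (1 + s ^+ 2) ^+ 2 -> q * phi w <= 8 * p.
  move=> q8; rewrite phiE; apply: (@le_trans _ _ (8 * (1 + s ^+ 2) ^+ 2 * (p * E))).
    by rewrite ler_wpM2r// mulr_ge0// ltW.
  have -> : 8 * (1 + s ^+ 2) ^+ 2 * (p * E) = 8 * p * ((1 + s ^+ 2) ^+ 2 * E).
    by ring.
  by rewrite ler_piMr// mulr_ge0// ltW.
have phi0 := normal_pdf_ge0 0 1 w.
have wE : `|w| = 2 * s by rewrite /s; field.
split.
- by rewrite -[leLHS]mul1r; apply: bound; nra.
- by rewrite normrM (ger0_norm phi0); apply: bound; rewrite wE; nra.
- rewrite normrM (ger0_norm phi0); apply: bound.
  apply: (le_trans (ler_normB _ _)); rewrite normr1 normrX wE; nra.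
- by apply: bound; rewrite wE; nra.
Qed.

(** The explicit solution of the heat equation [u_v = u_xx / 2] with initial
    value the indicator of [`]-oo, a]]: at time [v] it is the probability that
    [x] plus a centred Gaussian of variance [v] is at most [a]. *)
Definition heat a v x := Phi ((a - x) / Num.sqrt v).

Definition heat_dx a v x := - (phi ((a - x) / Num.sqrt v) / Num.sqrt v).

Definition heat_dv a v x :=
  - ((a - x) / Num.sqrt v * phi ((a - x) / Num.sqrt v) / (2 * v)).

(** Rescaling the argument moves it by a multiple of itself, so the second
    order error is [w ^+ 2] times the slope of the density at a comparable
    point, which the cubic decay of the density controls. *)
Lemma Phi_rescale : exists2 K, 0 < K & forall w d, 0 <= d <= 1 ->
  `|Phi (w / Num.sqrt (1 + d)) - Phi w + d / 2 * (w * phi w)| <= K * d ^+ 2.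
Proof.
have [K K0 decay] := std_normal_pdf_decay.
exists (5 * K) => [|w d /andP[d0 d1]]; first by rewrite mulr_gt0.
pose l := (Num.sqrt (1 + d))^-1; pose e := 1 - l.
have sd : Num.sqrt (1 + d) ^+ 2 = 1 + d by rewrite sqr_sqrtr// addr_ge0.
have sd1 : 1 <= Num.sqrt (1 + d).
  by rewrite -[leLHS]sqrtr1 ler_wsqrtr// lerDl.
have l0 : 0 < l by rewrite invr_gt0 (lt_le_trans _ sd1).
have l1 : l <= 1 by rewrite invf_le1// (lt_le_trans _ sd1).
have l2 : l ^+ 2 * (1 + d) = 1.
  by rewrite -sd -exprMn mulVf ?expr1n// gt_eqF// (lt_le_trans _ sd1).
have e0 : 0 <= e by rewrite subr_ge0.
have e1 : e <= 1 by rewrite /e; lra.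
(* [e] is the relative displacement; squaring [l = 1 - e] shows that it is
   [d / 2] up to second order *)
have el : (1 - 2 * e + e ^+ 2) * (1 + d) = 1.
  by rewrite -[RHS]l2; congr (_ * _); rewrite /e; ring.
have ed : e <= d by nra.
have ed2 : `|e - d / 2| <= d ^+ 2.
  have h1 : 2 * e - e ^+ 2 = d - d * (2 * e - e ^+ 2) by nra.
  have h2 : 2 * e - e ^+ 2 <= d by nra.
  have h3 : 0 <= 2 * e - e ^+ 2 by nra.
  rewrite ler_norml; apply/andP; split; nra.
have lw : w / Num.sqrt (1 + d) = w + (- e * w).
  by rewrite -/l /e; ring.
have T : `|Phi (w + (- e * w)) - Phi w - (- e * w) * phi w|
    <= 4 * K * d ^+ 2.
  have [->|w0] := eqVneq w 0.
    rewrite mulr0 addr0 subrr mul0r subrr normr0.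
    by rewrite mulr_ge0 ?sqr_ge0// mulr_ge0// ltW.
  have w2 : 0 < w ^+ 2 by rewrite exprn_even_gt0.
  (* along the displacement [`|x|] stays above [`|w| / 2] *)
  have M : forall x, `|x - w| <= `|- e * w| -> `|- (x * phi x)| <= 4 * K / w ^+ 2.
    move=> x; rewrite normrM normrN (ger0_norm e0) => xw.
    have xlw : l * `|w| <= `|x|.
      have -> : l = 1 - e by rewrite /e; ring.
      have := ler_normB x (x - w); rewrite subKr; nra.
    have l4 : 1 <= 4 * l ^+ 2 by nra.
    have w4x : w ^+ 2 <= 4 * `|x| ^+ 2.
      rewrite -[w ^+ 2]real_normK ?num_real//.
      have : (l * `|w|) ^+ 2 <= `|x| ^+ 2.
        by rewrite lerXn2r// nnegrE mulr_ge0// ltW.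
      rewrite exprMn => h; have := sqr_ge0 `|w|; nra.
    rewrite normrN normrM (ger0_norm (normal_pdf_ge0 _ _ _)).
    rewrite ler_pdivlMr//.
    have [_ _ _ dec] := decay x.
    apply: (@le_trans _ _ (`|x| * phi x * (4 * `|x| ^+ 2))).
      by rewrite ler_wpM2l// mulr_ge0// normal_pdf_ge0.
    have -> : `|x| * phi x * (4 * `|x| ^+ 2) = 4 * (`|x| ^+ 3 * phi x) by ring.
    by rewrite ler_wpM2l.
  apply: le_trans (taylor1_bound is_derive_Phi is_derive_std_normal_pdf M) _.
  rewrite exprMn sqrrN mulrA mulrAC divfK ?gt_eqF// ler_wpM2l//.
    by rewrite mulr_ge0// ltW.
  by rewrite lerXn2r.
rewrite lw; have [_ wK _ _] := decay w.
have -> : Phi (w + - e * w) - Phi w + d / 2 * (w * phi w) =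
  (Phi (w + - e * w) - Phi w - (- e * w) * phi w) - (e - d / 2) * (w * phi w).
  by ring.
apply: (le_trans (ler_normB _ _)).
have -> : 5 * K * d ^+ 2 = 4 * K * d ^+ 2 + d ^+ 2 * K by ring.
by rewrite lerD// normrM ler_pM.
Qed.

(** The remainder is quadratic for large [h] and cubic for small [h]: this form
    needs no moment of [h] beyond the second and is still of smaller order. *)
Lemma Phi_taylor : exists2 K, 0 < K & forall w h,
  `|Phi (w + h) - Phi w - h * phi w + h ^+ 2 / 2 * (w * phi w)|
    <= K * (h ^+ 2 * Num.min 1 `|h|).
Proof.
have [K K0 decay] := std_normal_pdf_decay.
exists (2 * K) => [|w h]; first by rewrite mulr_gt0.
rewrite (_ : 2 * K * _ = 2 * K * Num.min 1 `|h| * h ^+ 2); last by ring.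
have -> : h ^+ 2 / 2 * (w * phi w) = - (h ^+ 2 / 2 * (- (w * phi w))) by ring.
apply: (taylor2_bound is_derive_Phi is_derive_std_normal_pdf) => x xh.
have [h1|h1] := leP 1 `|h|.
  apply: (le_trans (ler_normB _ _)); rewrite !normrN.
  by have [_ ? _ _] := decay x; have [_ ? _ _] := decay w; lra.
apply: (@le_trans _ _ (K * `|x - w|)); last first.
  apply: (@le_trans _ _ (K * `|h|)); first by rewrite ler_wpM2l// ltW.
  by rewrite ler_wpM2r//; lra.
apply: (mean_value_bound is_derive_std_normal_pdf2) => y _.
by have [] := decay y.
Qed.

(** One step of the Lindeberg exchange: an increment [h] of the argument is
    replaced by an increase [d] of the time. As [heat] solves the heat equation,
    the second order term in [h] and the first order term in [d] have the same
    coefficient, so that their difference vanishes on average when [h] has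
    variance [d]. *)
Lemma heat_step v0 : 0 < v0 -> exists2 K : R, 0 < K &
  [/\ forall a v x, v0 <= v -> `|heat_dx a v x| <= K,
      forall a v x, v0 <= v -> `|heat_dv a v x| <= K &
      forall a v d x h, v0 <= v -> 0 <= d <= v0 ->
      `|heat a v (x + h) - (heat a (v + d) x + h * heat_dx a v x
        + (h ^+ 2 - d) * heat_dv a v x)|
      <= K * (h ^+ 2 * Num.min 1 `|h| + d ^+ 2)].
Proof.
move=> v00.
have [K1 K10 decay] := std_normal_pdf_decay.
have [K2 K20 time] := Phi_rescale.
have [K3 K30 space] := Phi_taylor.
pose c := (Num.sqrt v0)^-1; have s0 : 0 < Num.sqrt v0 by rewrite sqrtr_gt0.
have c0 : 0 < c by rewrite invr_gt0.
have vpos v : v0 <= v -> 0 < v by exact: lt_le_trans.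
have cv v : v0 <= v -> 0 < (Num.sqrt v)^-1 <= c.
  move=> vv; rewrite invr_gt0 sqrtr_gt0 vpos//= lef_pV2 ?posrE ?sqrtr_gt0 ?vpos//.
  by rewrite ler_wsqrtr.
have sv v : v0 <= v -> v^-1 = (Num.sqrt v)^-1 ^+ 2.
  by move=> vv; rewrite exprVn sqr_sqrtr// ltW// vpos.
have cv2 v : v0 <= v -> (Num.sqrt v)^-1 ^+ 2 <= c ^+ 2.
  by move=> vv; have /andP[? ?] := cv v vv; rewrite lerXn2r// nnegrE ltW.
(* powers of [c] up to the fourth occur when the bounds for unit variance are
   rescaled to variances above [v0] *)
pose K := (K1 + K2 + K3) * (1 + c) ^+ 4.
have KS0 : 0 < K1 + K2 + K3 by rewrite !addr_gt0.
have c4 : forall k, (k <= 4)%N -> c ^+ k <= (1 + c) ^+ 4.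
  move=> k k4; apply: (@le_trans _ _ ((1 + c) ^+ k)).
    by rewrite lerXn2r ?nnegrE ?addr_ge0 ?(ltW c0)// lerDr.
  by rewrite ler_weXn2l// lerDl ltW.
have KE q k : 0 <= q <= K1 + K2 + K3 -> (k <= 4)%N -> q * c ^+ k <= K.
  move=> /andP[q0 qK] k4; apply: ler_pM => //; first by rewrite exprn_ge0// ltW.
  exact: c4.
exists K; first by rewrite mulr_gt0// exprn_gt0// addr_gt0.
split=> [a v x vv|a v x vv|a v d x h vv /andP[d0 dv0]].
- have /andP[cv0 cvc] := cv v vv.
  rewrite normrN normrM (ger0_norm (ltW cv0)) (ger0_norm (normal_pdf_ge0 _ _ _)).
  apply: le_trans (KE K1 1%N _ _) => //; last by rewrite ltW//=; lra.
  have [p1 _ _ _] := decay ((a - x) / Num.sqrt v).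
  by rewrite expr1; apply: ler_pM => //; first exact: normal_pdf_ge0.
- have /andP[cv0 cvc] := cv v vv.
  rewrite normrN normrM invfM (sv v vv).
  apply: le_trans (KE K1 2%N _ _) => //; last by rewrite ltW//=; lra.
  apply: ler_pM => //; first by have [] := decay ((a - x) / Num.sqrt v).
  rewrite ger0_norm; last by rewrite mulr_ge0// sqr_ge0.
  have := cv2 v vv; have := sqr_ge0 (Num.sqrt v)^-1; lra.
have /andP[cv0 cvc] := cv v vv; have vp := vpos v vv.
(* reduction to unit variance: argument, increment and time step in units of
   the standard deviation and of the variance *)
pose w := (a - x) / Num.sqrt v; pose y := - h / Num.sqrt v; pose r := d / v.
have r01 : 0 <= r <= 1.
  by rewrite (divr_ge0 d0 (ltW vp))/= ler_pdivrMr// mul1r (le_trans dv0).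
have sv0 : 0 < Num.sqrt v by rewrite sqrtr_gt0 vpos.
have E1 : heat a v (x + h) = Phi (w + y).
  by rewrite /heat /w /y; congr Phi; field; rewrite gt_eqF.
have E2 : heat a (v + d) x = Phi (w / Num.sqrt (1 + r)).
  rewrite /heat /w -mulrA -invfM -sqrtrM ?(ltW vp)//.
  by rewrite mulrDr mulr1 /r mulrCA divff ?mulr1// gt_eqF// vpos.
have E3 : h * heat_dx a v x = y * phi w by rewrite /heat_dx /y /w; ring.
have y2 : y ^+ 2 = h ^+ 2 / v by rewrite /y exprMn sqrrN sv.
have E4 : (h ^+ 2 - d) * heat_dv a v x =
    - (y ^+ 2 / 2 * (w * phi w)) + r / 2 * (w * phi w).
  by rewrite y2 /heat_dv /r -/w; field; rewrite gt_eqF// vpos.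
rewrite E1 E2 E3 E4.
have -> : Phi (w + y) - (Phi (w / Num.sqrt (1 + r)) + y * phi w +
      (- (y ^+ 2 / 2 * (w * phi w)) + r / 2 * (w * phi w))) =
    (Phi (w + y) - Phi w - y * phi w + y ^+ 2 / 2 * (w * phi w))
    - (Phi (w / Num.sqrt (1 + r)) - Phi w + r / 2 * (w * phi w)) by ring.
apply: (le_trans (ler_normB _ _)); rewrite mulrDr lerD//.
- apply: le_trans (space _ _) _.
  have ym : Num.min 1 `|y| <= (1 + c) * Num.min 1 `|h|.
    have cm : (1 + c) * Num.min 1 `|h| = Num.min (1 + c) ((1 + c) * `|h|).
      by rewrite minr_pMr ?mulr1// addr_ge0// ltW.
    rewrite cm le_min !ge_min lerDl (ltW c0)/=; apply/orP; right.
    rewrite /y normrM normrN (ger0_norm (ltW cv0)) mulrC ler_wpM2r//.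
    by apply: (le_trans cvc); rewrite lerDr.
  have y2c : y ^+ 2 <= c ^+ 2 * h ^+ 2.
    by rewrite y2 sv// mulrC ler_wpM2r ?sqr_ge0// cv2.
  have m0 : 0 <= Num.min 1 `|h| by rewrite le_min ler01/=.
  apply: (@le_trans _ _ (K3 * ((c ^+ 2 * h ^+ 2) * ((1 + c) * Num.min 1 `|h|)))).
    by rewrite ler_wpM2l ?(ltW K30)// ler_pM ?sqr_ge0// le_min ler01/=.
  have -> : K3 * (c ^+ 2 * h ^+ 2 * ((1 + c) * Num.min 1 `|h|)) =
    K3 * (c ^+ 2 * (1 + c)) * (h ^+ 2 * Num.min 1 `|h|) by ring.
  apply: ler_wpM2r; first by rewrite mulr_ge0// sqr_ge0.
  rewrite /K; apply: ler_pM; first exact: ltW.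
  + by rewrite mulr_ge0 ?sqr_ge0// addr_ge0// ltW.
  + by lra.
  + have D2 : 1 <= (1 + c) ^+ 2 by nra.
    have -> : (1 + c) ^+ 4 = (1 + c) ^+ 2 * (1 + c) ^+ 2 by ring.
    by apply: ler_pM; rewrite ?sqr_ge0 ?addr_ge0 ?(ltW c0)//; nra.
- apply: le_trans (time _ _ r01) _.
  have -> : r ^+ 2 = (Num.sqrt v)^-1 ^+ 4 * d ^+ 2.
    by rewrite /r exprMn sv//; ring.
  rewrite mulrA ler_wpM2r ?sqr_ge0//.
  apply: le_trans (KE K2 4%N _ _) => //; last by rewrite ltW//=; lra.
  rewrite ler_wpM2l ?(ltW K20)// lerXn2r ?nnegrE ?(ltW c0) ?(ltW cv0)//.
Qed.

End heat_kernel.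

(** * Independence and expectations *)

Section independence.
Context {R : realType} {d : measure_display} {T : measurableType d}.
Context (P : probability T R).

Lemma bounded_integrable (f : T -> R) C : measurable_fun setT f ->
  (forall w, `|f w| <= C) -> P.-integrable setT (EFin \o f).
Proof.
move=> mf fC; apply: (@le_integrable _ _ _ _ _ measurableT _ (cst C%:E)) => //.
- exact/measurable_EFinP.
- by move=> x _ /=; rewrite lee_fin (le_trans (fC _))// ler_norm.
- exact: finite_measure_integrable_cst.
Qed.

Section past_and_present.
Context {d'} {S : measurableType d'} (Z : nat -> {RV P >-> S}).
Hypothesis indepZ : mutually_independent Z.

Let past k : set (set T) := [set E | exists2 A : nat -> set S,
  (forall i, measurable (A i)) & E = \bigcap_(i in `I_k) (Z i @^-1` A i)].

Let probability_past k (A : nat -> set S) : (forall i, measurable (A i)) ->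
  (P (\bigcap_(i in `I_k) (Z i @^-1` A i)) =
   \prod_(i < k) P (Z i @^-1` A i))%E.
Proof.
move=> mA; pose J := [fset x in iota 0 k]%fset.
have JE : [set` J] = `I_k.
  by apply/seteqP; split => i /=; rewrite !inE/= mem_iota add0n.
have := indepZ J mA; rewrite JE => ->.
rewrite -(big_mkord xpredT (fun i => P (Z i @^-1` A i))) /index_iota subn0.
apply: perm_big; apply: uniq_perm; rewrite ?fset_uniq ?iota_uniq// => i.
by rewrite !inE/=.
Qed.

Let measurable_past k : past k `<=` measurable.
Proof.
move=> _ [A mA ->]; apply: bigcap_measurableType => // i _.
exact: measurable_funPTI.
Qed.

Let past_setT k : past k setT.
Proof.
exists (fun=> setT) => //; apply/seteqP; split=> // w _ i _.
Qed.

Let past_setI k : setI_closed (past k).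
Proof.
move=> _ _ [A mA ->] [B mB ->]; exists (fun i => A i `&` B i).
  by move=> i; exact: measurableI.
by rewrite -bigcapI; apply: eq_bigcapr => i _; rewrite preimage_setI.
Qed.

(** Both sides are finite measures in the first event, and on the cylinders
    they agree by independence of finitely many variables. *)
Lemma independent_past k (E : set T) (B : set S) : measurable B ->
  <<s past k >> E -> (P (E `&` Z k @^-1` B) = P E * P (Z k @^-1` B))%E.
Proof.
move=> mB pE; have mZB : measurable (Z k @^-1` B) by exact: measurable_funPTI.
pose c : {nonneg R} := NngNum (fine_ge0 (measure_ge0 P (Z k @^-1` B))).
have cE : c%:num%:E = P (Z k @^-1` B) by rewrite /= fineK// fin_num_measure.
suff : mrestr P mZB E = mscale c P E by rewrite /mrestr/= /mscale/= => ->; rewrite cE muleC.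
apply: (g_sigma_algebra_measure_unique (past k) _ (fun=> setT)) => //.
- by rewrite bigcup_const//; exists 0%N.
- move=> _ [A mA ->].
  rewrite -[LHS]/(P (_ `&` _)) -[RHS]/(c%:num%:E * P _)%E cE.
  pose A' i := if i == k then B else A i.
  have mA' i : measurable (A' i) by rewrite /A'; case: ifPn.
  have -> : \bigcap_(i in `I_k) (Z i @^-1` A i) `&` Z k @^-1` B =
      \bigcap_(i in `I_k.+1) (Z i @^-1` A' i).
    apply/seteqP; split=> [w [ZA ZB] i /= ik|w ZA].
      rewrite /A'; case: eqVneq => [->//|ik']; apply: ZA => /=.
      by rewrite ltn_neqAle ik' -ltnS.
    split=> [i /= ik|].
      by have := ZA i (ltnW ik); rewrite /= /A' (ltn_eqF ik).
    by have := ZA k (ltnSn k); rewrite /= /A' eqxx.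
  rewrite !probability_past// big_ord_recr/= muleC /A' eqxx; congr (_ * _)%E.
  by apply: eq_bigr => i _; rewrite (ltn_eqF (ltn_ord i)).
- by move=> _; rewrite /mrestr (le_lt_trans (probability_le1 P _)) ?ltry//; exact: measurableI.
Qed.

(** The partial sum is measurable with respect to the past. *)
Lemma independent_partial_sum (phi : S -> R) k (A B : set R) :
  measurable_fun setT phi -> measurable A -> measurable B ->
  (P ((fun w => \sum_(i < k) phi (Z i w))%R @^-1` A `&` (phi \o Z k) @^-1` B) =
   P ((fun w => \sum_(i < k) phi (Z i w))%R @^-1` A) *
   P ((phi \o Z k) @^-1` B))%E.
Proof.
move=> mphi mA mB; rewrite comp_preimage.
apply: independent_past.
  by rewrite -[_ @^-1` _]setTI; exact: mphi.
have mS : measurable_fun (setT : set (g_sigma_algebraType (past k)))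
    (fun w => \sum_(i < k) phi (Z i w)).
  apply: measurable_sum => i.
  move=> _ C mC; rewrite setTI; apply: sub_sigma_algebra.
  exists (fun j => if j == i :> nat then phi @^-1` C else setT).
    move=> j; case: ifPn => // _.
    by rewrite -[_ @^-1` _]setTI; exact: mphi.
  apply/seteqP; split=> [w wC j /= jk|w wC].
    by case: eqVneq => [->|].
  by have := wC i (ltn_ord i); rewrite /= eqxx.
by have := mS measurableT A mA; rewrite setTI.
Qed.

End past_and_present.

(** The joint law of independent variables is the product of their laws, so
    the factorization is Fubini. *)
Lemma independent_expectation (U V : T -> R) (f g : R -> R) C :
  measurable_fun setT U -> measurable_fun setT V ->
  (forall A B, measurable A -> measurable B ->
    (P (U @^-1` A `&` V @^-1` B) = P (U @^-1` A) * P (V @^-1` B))%E) ->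
  measurable_fun setT f -> measurable_fun setT g -> (forall x, `|f x| <= C) ->
  P.-integrable setT (EFin \o (g \o V)) ->
  P.-integrable setT (fun w => (f (U w) * g (V w))%:E) /\
  \int[P]_w (f (U w) * g (V w)) = \int[P]_w f (U w) * \int[P]_w g (V w).
Proof.
move=> mU mV UV mf mg fC ig.
have mfU : measurable_fun setT (f \o U) by exact: measurableT_comp.
have mgV : measurable_fun setT (g \o V) by exact: measurableT_comp.
have ifg : P.-integrable setT (fun w => (f (U w) * g (V w))%:E).
  have mfg : measurable_fun setT (fun w => f (U w) * g (V w)).
    by apply: measurable_funM.
  have iC := integrableZl measurableT C ig.
  apply: (le_integrable _ _ _ iC) => //; first exact/measurable_EFinP.
  move=> w _ /=; rewrite lee_fin normrM normrM ler_wpM2r//.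
  by rewrite (le_trans (fC _))// ler_norm.
split=> //.
pose U' := rv_of P mU; pose V' := rv_of P mV.
have mUV : measurable_fun setT (fun w => (U w, V w)) by exact: measurable_fun_pair.
pose UV' := rv_of P mUV.
pose F (z : R * R) := (f z.1 * g z.2)%:E.
have mF : measurable_fun setT F.
  apply/measurable_EFinP; apply: measurable_funM.
    exact: measurableT_comp mf measurable_fst.
  exact: measurableT_comp mg measurable_snd.
have lawE (A : set (R * R)) : measurable A ->
    (distribution P U' \x distribution P V')%E A = distribution P UV' A.
  apply: (@product_measure_unique _ _ _ _ R (distribution P U') (distribution P V') (distribution P UV')).
  by move=> B C' mB mC; rewrite -UV.
rewrite /Rintegral.
transitivity (fine (\int[distribution P UV']_z F z)%E).
  by rewrite integral_distribution.
pose PP : {measure set (R * R)%type -> \bar R} :=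
  (distribution P U' \x distribution P V')%E.
have intE (G : R * R -> \bar R) :
    (\int[distribution P UV']_z G z = \int[PP]_z G z)%E.
  by apply: eq_measure_integral => A mA _; exact/esym/lawE.
have iF : PP.-integrable setT F.
  apply/integrableP; split => //; rewrite -intE ge0_integral_distribution//.
    by case/integrableP : ifg.
  exact: measurableT_comp.
have igV : (distribution P V').-integrable setT (EFin \o g).
  apply: integrable_pushforward => //; exact/measurable_EFinP.
have ifP : P.-integrable setT (EFin \o (f \o U)).
  by apply: bounded_integrable mfU _ => w; exact: fC.
have ifU : (distribution P U').-integrable setT (EFin \o f).
  by apply: integrable_pushforward => //; exact/measurable_EFinP.
rewrite intE -integral12_prod_meas1//.
transitivity (fine (\int[distribution P U']_x
    ((f x)%:E * \int[distribution P V']_y (g y)%:E))%E).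
  congr fine; apply: eq_integral => x _; rewrite /fubini_F/= /F/=.
  under eq_integral do rewrite EFinM.
  by rewrite integralZl.
have JE := fineK (integrable_fin_num measurableT igV).
rewrite -JE.
rewrite integralZr// fineM//; last exact: integrable_fin_num.
rewrite JE; congr (fine _ * fine _).
  by apply: integral_distribution => //; exact/measurable_EFinP.
by apply: integral_distribution => //; exact/measurable_EFinP.
Qed.

End independence.

(** * The Lindeberg exchange *)

Lemma invn_cvg0 {R : realType} : n%:R^-1 @[n --> \oo] --> (0 : R).
Proof. by rewrite -cvg_shiftS; exact: cvg_harmonic. Qed.

Lemma inv_sqrtn_cvg0 {R : realType} :
  (Num.sqrt n%:R)^-1 @[n --> \oo] --> (0 : R).
Proof.
rewrite (_ : (fun n => _) = fun n : nat => Num.sqrt (n%:R^-1 : R)); last first.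
  by apply/funext => n; rewrite sqrtrV.
rewrite -[X in _ --> X](@sqrtr0 R).
apply: (cvg_comp _ Num.sqrt invn_cvg0); exact: sqrt_continuous.
Qed.

Section lindeberg.
Context {R : realType} {d : measure_display} {T : measurableType d}.
Context (P : probability T R).
Implicit Types (f g : R -> R) (a e v : R).

Lemma Rintegral_probability_cst (r : R) : \int[P]_w r = r.
Proof.
transitivity (r * fine (P setT)); first exact: Rintegral_cst.
by rewrite probability_setT mulr1.
Qed.

Lemma same_law_integral (U W : T -> R) g :
  measurable_fun setT U -> measurable_fun setT W ->
  (forall A, measurable A -> P (U @^-1` A) = P (W @^-1` A)) ->
  measurable_fun setT g -> P.-integrable setT (EFin \o (g \o W)) ->
  P.-integrable setT (EFin \o (g \o U)) /\
  \int[P]_w g (U w) = \int[P]_w g (W w).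
Proof.
move=> mU mW UW mg ig.
have mgE : measurable_fun setT (EFin \o g) by exact/measurable_EFinP.
pose U' := rv_of P mU; pose W' := rv_of P mW.
have lawE (h : R -> \bar R) :
    (\int[distribution P U']_x h x = \int[distribution P W']_x h x)%E.
  by apply: eq_measure_integral => A mA _; exact: UW.
have iU : P.-integrable setT (EFin \o (g \o U)).
  have mabs : measurable_fun setT (abse \o (EFin \o g)).
    exact: measurableT_comp.
  have abs0 y : (0 <= (abse \o (EFin \o g)) y)%E by exact: abse_ge0.
  apply/integrableP; split; first exact: measurableT_comp mgE mU.
  have /integrableP[_] := ig.
  rewrite -(@ge0_integral_distribution _ _ _ _ _ P W' (abse \o (EFin \o g)))//.
  by rewrite -lawE ge0_integral_distribution.
split=> //; congr fine.
rewrite -[LHS](@integral_distribution _ _ _ _ _ P U' (EFin \o g))//.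
by rewrite lawE (@integral_distribution _ _ _ _ _ P W' (EFin \o g)).
Qed.

Lemma measurable_heat a e : measurable_fun setT (heat a e).
Proof.
apply: continuous_measurable_fun => x; rewrite /heat.
apply: (@continuous_comp _ _ _ (fun y : R => (a - y) / Num.sqrt e)).
  by apply: cvgMr_tmp; apply: cvgB => //; exact: cvg_cst.
exact: Phi_continuous.
Qed.

Let measurable_arg a e : measurable_fun setT (fun x : R => (a - x) / Num.sqrt e).
Proof.
by apply: measurable_funM => //; apply: measurable_funB.
Qed.

Lemma measurable_heat_dx a e : measurable_fun setT (heat_dx a e).
Proof.
apply: measurableT_comp => //; apply: measurable_funM => //.
exact: measurableT_comp (measurable_normal_pdf _ _) (measurable_arg _ _).
Qed.

Lemma measurable_heat_dv a e : measurable_fun setT (heat_dv a e).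
Proof.
apply: measurableT_comp => //; apply: measurable_funM => //.
apply: measurable_funM; first exact: measurable_arg.
exact: measurableT_comp (measurable_normal_pdf _ _) (measurable_arg _ _).
Qed.

Lemma heat_ge0 a e x : 0 <= heat a e x. Proof. exact: Phi_ge0. Qed.

Lemma heat_le1 a e x : heat a e x <= 1. Proof. exact: Phi_le1. Qed.

Lemma integrable_heat a e (X : T -> R) : measurable_fun setT X ->
  P.-integrable setT (EFin \o (heat a e \o X)).
Proof.
move=> mX; apply: (@bounded_integrable _ _ _ P _ 1).
  exact: measurableT_comp (measurable_heat a e) mX.
by move=> w /=; rewrite ger0_norm ?heat_ge0 ?heat_le1.
Qed.

Context (V : nat -> T -> R) (W : T -> R) (v : R).
Hypothesis mV : forall i, measurable_fun setT (V i).
Hypothesis mW : measurable_fun setT W.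
Hypothesis indepV : forall k A B, measurable A -> measurable B ->
  (P ((fun w => \sum_(i < k) V i w)%R @^-1` A `&` V k @^-1` B) =
   P ((fun w => \sum_(i < k) V i w)%R @^-1` A) * P (V k @^-1` B))%E.
Hypothesis lawV : forall i A, measurable A -> P (V i @^-1` A) = P (W @^-1` A).
Hypothesis iW : P.-integrable setT (EFin \o W).
Hypothesis iW2 : P.-integrable setT (EFin \o (fun w => W w ^+ 2)).
Hypothesis EW : \int[P]_w W w = 0.
Hypothesis EW2 : \int[P]_w (W w ^+ 2) = v.

Let v_ge0 : 0 <= v.
Proof. by rewrite -EW2; apply: Rintegral_ge0 => w _; exact: sqr_ge0. Qed.

Let S k w := \sum_(i < k) V i w.

Let mS k : measurable_fun setT (S k).
Proof. exact: measurable_sum. Qed.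

Let rest_fun (s : R) x := (s * x) ^+ 2 * Num.min 1 `|s * x|.

Let measurable_rest s : measurable_fun setT (rest_fun s).
Proof.
have m1 : measurable_fun setT (fun x => s * x) by exact: measurable_funM.
apply: measurable_funM; first exact: measurable_funX.
by apply: measurable_minr => //; exact: measurableT_comp.
Qed.

Let integrable_rest s : P.-integrable setT (EFin \o (rest_fun s \o W)).
Proof.
apply: (le_integrable measurableT _ _ (integrableZl measurableT (s ^+ 2) iW2)).
  by apply/measurable_EFinP; exact: measurableT_comp.
move=> w _ /=; rewrite lee_fin /rest_fun exprMn !normrM ler_piMr//.
by rewrite ger0_norm ?ge_min ?lexx// le_min ler01/=.
Qed.

(** The two main terms of [heat_step] have mean zero: the new variable is
    independent of the sum before it, centred, and its variance is the time
    step. *)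
Lemma lindeberg_step e : 0 < e -> exists2 K : R, 0 < K &
  forall a s t k, e <= t -> s ^+ 2 * v <= e ->
  `|\int[P]_w heat a t (s * S k.+1 w)
    - \int[P]_w heat a (t + s ^+ 2 * v) (s * S k w)|
  <= K * (\int[P]_w rest_fun s (W w) + (s ^+ 2 * v) ^+ 2).
Proof.
move=> e0; have [K K0 [Kdx Kdv Kstep]] := heat_step e0.
exists K => // a s t k et dle; set D := s ^+ 2 * v.
have D0 : 0 <= D by rewrite mulr_ge0// sqr_ge0.
have msS j : measurable_fun setT (fun w => s * S j w) by exact: measurable_funM.
pose A x := heat_dx a t (s * x); pose B x := heat_dv a t (s * x).
have msx : measurable_fun setT (fun x : R => s * x) by exact: measurable_funM.
have mA : measurable_fun setT A by exact: measurableT_comp (measurable_heat_dx a t) msx.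
have mB : measurable_fun setT B by exact: measurableT_comp (measurable_heat_dv a t) msx.
pose g1 x := s * x; pose g2 x := (s * x) ^+ 2 - D.
have mg2 : measurable_fun setT g2.
  by apply: measurable_funB => //; exact: measurable_funX.
have ig1 : P.-integrable setT (EFin \o (g1 \o W)) by exact: (integrableZl measurableT s iW).
have is2 : P.-integrable setT (EFin \o (fun w => s ^+ 2 * W w ^+ 2)).
  exact: (integrableZl measurableT (s ^+ 2) iW2).
have ig2 : P.-integrable setT (EFin \o (g2 \o W)).
  have := integrableB measurableT is2 (finite_measure_integrable_cst P D measurableT).
  by congr integrable; apply/funext => w /=; rewrite /g2 exprMn.
have [ig1k Eg1] := same_law_integral (mV k) mW (lawV k) msx ig1.
have [ig2k Eg2] := same_law_integral (mV k) mW (lawV k) mg2 ig2.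
have [irk Er] := same_law_integral (mV k) mW (lawV k) (measurable_rest s) (integrable_rest s).
have E1 : \int[P]_w g1 (V k w) = 0 by rewrite Eg1 RintegralZl// EW mulr0.
have E2 : \int[P]_w g2 (V k w) = 0.
  rewrite Eg2 /g2; under eq_Rintegral do rewrite exprMn.
  rewrite RintegralB//; last exact: finite_measure_integrable_cst.
  by rewrite RintegralZl// EW2 Rintegral_probability_cst subrr.
have [iAg EAg] := independent_expectation (mS k) (mV k) (indepV k) mA msx
  (fun x => Kdx a t (s * x) et) ig1k.
have [iBg EBg] := independent_expectation (mS k) (mV k) (indepV k) mB mg2
  (fun x => Kdv a t (s * x) et) ig2k.
have i1 := integrable_heat a t (msS k.+1).
have i0 := integrable_heat a (t + D) (msS k).
have iAB := integrableD measurableT iAg iBg.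
have i0AB := integrableD measurableT i0 iAB.
have iC : P.-integrable setT (EFin \o cst (D ^+ 2)) by exact: finite_measure_integrable_cst.
have iR := integrableZl measurableT K (integrableD measurableT irk iC).
have H : \int[P]_w (heat a (t + D) (s * S k w)
    + (A (S k w) * g1 (V k w) + B (S k w) * g2 (V k w)))
    = \int[P]_w heat a (t + D) (s * S k w).
  by rewrite !RintegralD// EAg EBg E1 E2 !mulr0 !addr0.
have iDiff : P.-integrable setT (EFin \o (fun w => heat a t (s * S k.+1 w) -
    (heat a (t + D) (s * S k w)
      + (A (S k w) * g1 (V k w) + B (S k w) * g2 (V k w))))).
  exact: (integrableB measurableT i1 i0AB).
rewrite -H -RintegralB//.
apply: (le_trans (le_normr_Rintegral measurableT iDiff)).
have -> : \int[P]_w rest_fun s (W w) + D ^+ 2 =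
    \int[P]_w (rest_fun s (V k w) + D ^+ 2).
  by rewrite RintegralD// Er Rintegral_probability_cst.
rewrite -RintegralZl//; last exact: (integrableD measurableT irk iC).
apply: le_Rintegral => //.
  exact: (integrable_abse iDiff).
move=> w _ /=.
have -> : s * S k.+1 w = s * S k w + s * V k w.
  by rewrite /S big_ord_recr/= mulrDr.
have := Kstep a t D (s * S k w) (s * V k w) et.
rewrite D0 dle => /(_ isT); congr (`|_ - _| <= _).
by rewrite /A /B /g1 /g2; ring.
Qed.

Let integrable_truncated n : P.-integrable setT
  (EFin \o (fun w => W w ^+ 2 * Num.min 1 (`|W w| / Num.sqrt n%:R))).
Proof.
apply: (le_integrable measurableT _ _ iW2).
  apply/measurable_EFinP; apply: measurable_funM; first exact: measurable_funX.
  apply: measurable_minr => //; apply: measurable_funM => //.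
  exact: measurableT_comp.
move=> w _ /=; rewrite lee_fin normrM ler_piMr//.
by rewrite ger0_norm ?ge_min ?lexx// le_min ler01/= divr_ge0// sqrtr_ge0.
Qed.

(** The truncated second moment vanishes by dominated convergence, which is
    what makes a finite second moment suffice. *)
Let truncated_cvg0 : (\int[P]_w (W w ^+ 2 * Num.min 1 (`|W w| / Num.sqrt n%:R)))
  @[n --> \oo] --> (0 : R).
Proof.
pose f_ n w := (W w ^+ 2 * Num.min 1 (`|W w| / Num.sqrt n%:R))%:E.
have mf_ n : measurable_fun setT (f_ n).
  by have /integrableP[] := integrable_truncated n.
have m01 (n : nat) w : 0 <= Num.min 1 (`|W w| / Num.sqrt n%:R) <= 1.
  by rewrite le_min ler01/= ge_min lexx andbT divr_ge0// sqrtr_ge0.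
have [|||_ _] := @dominated_convergence _ _ _ P _ measurableT f_ (cst 0%E)
    (EFin \o (fun w => W w ^+ 2)) mf_ _ _ iW2.
- exact: measurable_cst.
- apply: aeW => w _; apply: cvg_EFin; first exact: nearW.
  rewrite -[X in _ --> X](mulr0 (W w ^+ 2)); apply: cvgMl_tmp.
  apply: (@squeeze_cvgr _ _ _ _ (fun=> 0) (fun n => `|W w| * (Num.sqrt n%:R)^-1)).
  + by apply: nearW => n; rewrite (andP (m01 n w)).1/= ge_min lexx orbT.
  + exact: cvg_cst.
  + by rewrite -[X in _ --> X](mulr0 `|W w|); apply: cvgMl_tmp; exact: inv_sqrtn_cvg0.
- apply: aeW => w n _ /=; rewrite lee_fin normrM.
  by have /andP[h0 h1] := m01 n w; rewrite (ger0_norm h0) ger0_norm ?sqr_ge0// ler_piMr// sqr_ge0.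
by rewrite integral_cst// mul0e => /fine_cvgP[_]; apply.
Qed.

(** Telescoping: each of the [n] exchanges costs [o(1 / n)]. *)
Lemma lindeberg_cvg a e : 0 < e ->
  (\int[P]_w heat a e ((Num.sqrt n%:R)^-1 * \sum_(i < n) V i w)) @[n --> \oo]
  --> heat a (e + v) 0.
Proof.
move=> e0; have [K K0 step] := lindeberg_step e0.
pose s (n : nat) : R := (Num.sqrt n%:R)^-1.
have s2 n : (0 < n)%N -> s n ^+ 2 = n%:R^-1.
  by move=> n0; rewrite /s exprVn sqr_sqrtr.
have bound n : (0 < n)%N -> v / n%:R <= e ->
    `|\int[P]_w heat a e (s n * S n w) - heat a (e + v) 0| <=
    K * (\int[P]_w (W w ^+ 2 * Num.min 1 (`|W w| / Num.sqrt n%:R)) + v ^+ 2 / n%:R).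
  move=> n0 vn.
  (* the first [k] variables are in place, the time stands for the others *)
  pose E k := \int[P]_w heat a (e + v * (n - k)%:R / n%:R) (s n * S k w).
  have En : E n = \int[P]_w heat a e (s n * S n w).
    by rewrite /E subnn mulr0 mul0r addr0.
  have nR : n%:R != 0 :> R by rewrite pnatr_eq0 -lt0n.
  have E0 : E 0 = heat a (e + v) 0.
    transitivity (\int[P]_w heat a (e + v) 0).
      by apply: eq_Rintegral => w _; rewrite /S big_ord0 mulr0 subn0 mulfK.
    exact: Rintegral_probability_cst.
  rewrite -En -E0 -(telescope_sumr E (leq0n n)).
  apply: (le_trans (ler_norm_sum _ _ _)).
  have restE : \int[P]_w rest_fun (s n) (W w) =
      n%:R^-1 * \int[P]_w (W w ^+ 2 * Num.min 1 (`|W w| / Num.sqrt n%:R)).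
    rewrite -(s2 n n0) -(RintegralZl _ measurableT (integrable_truncated n)).
    apply: eq_Rintegral => w _; rewrite /rest_fun exprMn -mulrA normrM.
    have sn0 : 0 <= s n by rewrite invr_ge0 sqrtr_ge0.
    by rewrite (ger0_norm sn0) [s n * _]mulrC.
  set rho := \int[P]_w (W w ^+ 2 * _) in restE *; clearbody rho.
  apply: (@le_trans _ _ (\sum_(0 <= k < n) K * (n%:R^-1 * rho + (n%:R^-1 * v) ^+ 2))).
    rewrite !big_nat; apply: ler_sum => k /andP[_ kn].
    have e1 : e <= e + v * (n - k.+1)%:R / n%:R.
      rewrite lerDl.
      exact: (divr_ge0 (mulr_ge0 v_ge0 (ler0n _ _)) (ler0n _ _)).
    have vs : s n ^+ 2 * v <= e by rewrite (s2 n n0) mulrC.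
    have tE : e + v * (n - k.+1)%:R / n%:R + s n ^+ 2 * v =
        e + v * (n - k)%:R / n%:R.
      by rewrite (s2 n n0) -(subnSK kn) -natr1; ring.
    have := step a (s n) _ k e1 vs.
    by rewrite tE restE (s2 n n0).
  rewrite sumr_const_nat subn0 -[leLHS]mulr_natr le_eqVlt; apply/orP; left.
  by apply/eqP; field; exact: nR.
apply/subr_cvg0/norm_cvg0P.
pose rho n := \int[P]_w (W w ^+ 2 * Num.min 1 (`|W w| / Num.sqrt n%:R)).
apply: (@squeeze_cvgr _ _ _ _ (fun=> 0) (fun n => K * (rho n + v ^+ 2 / n%:R))).
- near=> n; rewrite normr_ge0/=; apply: bound.
    by near: n; exists 1%N.
  near: n; have : v / n%:R @[n --> \oo] --> (0 : R).
    by rewrite -[X in _ --> X](mulr0 v); apply: cvgMl_tmp; exact: invn_cvg0.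
  by move=> vn0; exact: (cvgr_le _ vn0).
- exact: cvg_cst.
- rewrite -[X in _ --> X](mulr0 K); apply: cvgMl_tmp.
  rewrite -[X in _ --> X]addr0; apply: cvgD; first exact: truncated_cvg0.
  by rewrite -[X in _ --> X](mulr0 (v ^+ 2)); apply: cvgMl_tmp; exact: invn_cvg0.
Unshelve. all: by end_near. Qed.

End lindeberg.

(** * From smooth profiles to distribution functions *)

Section smoothing.
Context {R : realType} {d : measure_display} {T : measurableType d}.
Context (P : probability T R).
Implicit Types (A B : set T) (x y eta : R).

Local Notation Pr A := (fine (P A)).

Lemma fine_probabilityK A : measurable A -> (Pr A)%:E = P A.
Proof. by move=> mA; rewrite fineK// fin_num_measure. Qed.

Lemma fine_probability_ge0 A : 0 <= Pr A. Proof. exact: fine_ge0. Qed.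

Lemma le_fine_probability A B : measurable A -> measurable B -> A `<=` B ->
  Pr A <= Pr B.
Proof.
by move=> mA mB AB; rewrite -lee_fin !fine_probabilityK// le_measure// inE.
Qed.

Lemma fine_probabilityU A B : measurable A -> measurable B ->
  Pr (A `|` B) <= Pr A + Pr B.
Proof.
move=> mA mB; rewrite -lee_fin EFinD !fine_probabilityK//; last exact: measurableU.
exact: measureU2.
Qed.

Lemma fine_probabilityC A : measurable A -> Pr (~` A) = 1 - Pr A.
Proof. by move=> mA; rewrite probability_setC// fineB// fin_num_measure. Qed.

Lemma Rintegral_probability_indic A : measurable A -> \int[P]_w \1_A w = Pr A.
Proof. by move=> mA; rewrite /Rintegral integral_indic// setIT. Qed.

Lemma measurable_le (X : T -> R) x : measurable_fun setT X ->
  measurable [set w | X w <= x].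
Proof.
move=> mX; rewrite -[X in measurable X]setTI.
by have := mX measurableT `]-oo, x]%classic (measurable_itv _); rewrite set_itvE.
Qed.

Lemma measurable_lt (X : T -> R) x : measurable_fun setT X ->
  measurable [set w | X w < x].
Proof.
move=> mX; rewrite -[X in measurable X]setTI.
by have := mX measurableT `]-oo, x[%classic (measurable_itv _); rewrite set_itvE.
Qed.

Lemma measurable_ge (X : T -> R) x : measurable_fun setT X ->
  measurable [set w | x <= X w].
Proof.
move=> mX; rewrite -[X in measurable X]setTI.
by have := mX measurableT `[x, +oo[%classic (measurable_itv _); rewrite set_itvE.
Qed.

Lemma measurable_gt (X : T -> R) x : measurable_fun setT X ->
  measurable [set w | x < X w].
Proof.
move=> mX; rewrite -[X in measurable X]setTI.
by have := mX measurableT `]x, +oo[%classic (measurable_itv _); rewrite set_itvE.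
Qed.

Lemma measurable_norm_gt (X : T -> R) x : measurable_fun setT X ->
  measurable [set w | x < `|X w|].
Proof. by move=> mX; apply: measurable_gt; exact: measurableT_comp. Qed.

Lemma Phi_tail eta : 0 < eta -> exists2 y : R, 0 < y & 1 - Phi y <= eta.
Proof.
move=> eta0; have /cvgrPdist_le/(_ _ eta0) tail := @Phi_cvgy R.
near (pinfty_nbhs R) => y; exists y; first by near: y; exact: nbhs_pinfty_gt.
rewrite -[leLHS]ger0_norm ?subr_ge0 ?Phi_le1//.
by near: y.
Unshelve. all: by end_near. Qed.

(** After a shift by [y] the profile stays on one side of the indicator of
    [`]-oo, x]], up to the Gaussian tail at [y / Num.sqrt e]. *)
Lemma heat_sandwich (X : T -> R) x y e : measurable_fun setT X -> 0 < e ->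
  \int[P]_w heat (x - y) e (X w) - (1 - Phi (y / Num.sqrt e)) <=
    Pr [set w | X w <= x] <=
  \int[P]_w heat (x + y) e (X w) + (1 - Phi (y / Num.sqrt e)).
Proof.
move=> mX e0; have mA := measurable_le x mX; set A := [set w | X w <= x] in mA *.
set q := 1 - _; have q0 : 0 <= q by rewrite subr_ge0 Phi_le1.
have s0 : 0 < (Num.sqrt e)^-1 by rewrite invr_gt0 sqrtr_gt0.
have iA : P.-integrable setT (EFin \o \1_A).
  by apply: (@bounded_integrable _ _ _ _ _ 1) => // w; rewrite indicE normr_nat lern1 leq_b1.
have iq : P.-integrable setT (EFin \o cst q) by exact: finite_measure_integrable_cst.
have ih a := integrable_heat P a e mX.
have AE := Rintegral_probability_indic mA.
have qE := Rintegral_probability_cst P q.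
apply/andP; split.
- rewrite lerBlDr -AE -qE -RintegralD//.
  have iAq : P.-integrable setT (EFin \o (fun w => \1_A w + q)).
    exact: (integrableD measurableT iA iq).
  apply: (le_Rintegral measurableT (ih _) iAq).
  move=> w _ /=; rewrite indicE.
  have [wA|] := boolP (w \in A).
    by apply: (le_trans (heat_le1 _ _ _)); rewrite lerDl.
  rewrite notin_setE /A/= => /negP; rewrite -ltNge => xX; rewrite add0r.
  rewrite /q -PhiN; apply: Phi_ler; rewrite -mulNr ler_wpM2r ?(ltW s0)//; lra.
- rewrite -AE -qE -(RintegralD measurableT (ih _) iq).
  have ihq : P.-integrable setT (EFin \o (fun w => heat (x + y) e (X w) + q)).
    exact: (integrableD measurableT (ih _) iq).
  apply: (le_Rintegral measurableT iA ihq).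
  move=> w _ /=; rewrite indicE.
  have [|wA] := boolP (w \in A); last by rewrite addr_ge0// heat_ge0.
  rewrite inE /A/= => Xx; rewrite -lerBlDr /q opprB addrC subrK.
  by apply: Phi_ler; rewrite ler_wpM2r ?(ltW s0)//; lra.
Qed.

Context (X : nat -> T -> R) (v : R).
Hypothesis mX : forall n, measurable_fun setT (X n).
Hypothesis v0 : 0 <= v.
Hypothesis smooth : forall a e, 0 < e ->
  (\int[P]_w heat a e (X n w)) @[n --> \oo] --> heat a (e + v) 0.

Lemma smooth_le x y e eta : 0 < e -> 0 < eta -> \forall n \near \oo,
  Phi ((x - y) / Num.sqrt (e + v)) - (1 - Phi (y / Num.sqrt e)) - eta <=
    Pr [set w | X n w <= x] <=
  Phi ((x + y) / Num.sqrt (e + v)) + (1 - Phi (y / Num.sqrt e)) + eta.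
Proof.
move=> e0 eta0.
have lo := @smooth (x - y) e e0; have hi := @smooth (x + y) e e0.
near=> n; have /andP[l1 l2] := heat_sandwich x y (mX n) e0.
apply/andP; split.
- apply: le_trans l1; rewrite addrAC lerD2r.
  have -> : Phi ((x - y) / Num.sqrt (e + v)) = heat (x - y) (e + v) 0.
    by rewrite /heat subr0.
  near: n; apply: (cvgr_ge _ lo); lra.
- apply: (le_trans l2); rewrite [leRHS]addrAC lerD2r.
  have -> : Phi ((x + y) / Num.sqrt (e + v)) = heat (x + y) (e + v) 0.
    by rewrite /heat subr0.
  near: n; apply: (cvgr_le _ hi); lra.
Unshelve. all: by end_near. Qed.

(** For tightness a fixed smoothing variance is enough, here 1. *)
Lemma smooth_tight eta : 0 < eta -> exists2 M, 0 < M &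
  \forall n \near \oo, Pr [set w | M < `|X n w|] <= eta.
Proof.
move=> eta0; have eta8 : 0 < eta / 8 by rewrite divr_gt0.
have [y y0 hy] := Phi_tail eta8.
pose s := Num.sqrt (1 + v).
have s0 : 0 < s by rewrite sqrtr_gt0 ltr_pwDl.
have M0 : 0 < y + y * s by rewrite addr_gt0// mulr_gt0.
exists (y + y * s + 1) => //; first by rewrite addr_gt0.
set M := y + y * s.
near=> n.
have hiM : 1 - eta / 2 <= Pr [set w | X n w <= M].
  have : Phi ((M - y) / Num.sqrt (1 + v)) - (1 - Phi (y / Num.sqrt 1)) - eta / 8
      <= Pr [set w | X n w <= M].
    by near: n; have := smooth_le M y ltr01 eta8; apply: filterS => n /andP[].
  have -> : (M - y) / Num.sqrt (1 + v) = y.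
    by rewrite /M addrAC subrr add0r mulfK// gt_eqF.
  by rewrite sqrtr1 divr1; lra.
have loM : Pr [set w | X n w <= - M] <= eta / 2.
  have : Pr [set w | X n w <= - M] <=
    Phi ((- M + y) / Num.sqrt (1 + v)) + (1 - Phi (y / Num.sqrt 1)) + eta / 8.
    by near: n; have := smooth_le (- M) y ltr01 eta8; apply: filterS => n /andP[].
  have -> : (- M + y) / Num.sqrt (1 + v) = - y.
    by rewrite /M opprD addrAC addNr add0r mulNr mulfK// gt_eqF.
  by rewrite PhiN sqrtr1 divr1; lra.
have m1 := measurable_le M (mX n); have m2 := measurable_le (- M) (mX n).
apply: (@le_trans _ _ (Pr (~` [set w | X n w <= M] `|` [set w | X n w <= - M]))).
  apply: le_fine_probability.
  - exact: measurable_norm_gt.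
  - by apply: measurableU => //; exact: measurableC.
  - move=> w /=; rewrite ltNge => /negP; rewrite ler_norml => h.
    have [?|?] := leP (X n w) M; [right|by left].
    by rewrite leNgt; apply/negP => ?; apply: h; apply/andP; split; lra.
apply: (le_trans (fine_probabilityU _ _)) => //; first exact: measurableC.
by rewrite fine_probabilityC//; lra.
Unshelve. all: by end_near. Qed.

(** The smoothing variance is [y ^+ 4], so that the width [y] of the window and
    the Gaussian tail at [y / y ^+ 2] vanish together with [y]. *)
Lemma smooth_cvg_le sigma x : 0 < sigma -> v = sigma ^+ 2 ->
  Pr [set w | X n w <= x] @[n --> \oo] --> Phi (x / sigma).
Proof.
move=> s0 vE.
have scale (k : R) : Phi ((x + k * y) / Num.sqrt (y ^+ 2 ^+ 2 + v)) @[y --> (0 : R)^'+]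
    --> Phi (x / sigma).
  apply: cvg_at_right_filter.
  have -> : x / sigma = (x + k * 0) / Num.sqrt (0 ^+ 2 ^+ 2 + v).
    by rewrite mulr0 addr0 !expr0n/= add0r vE sqrtr_sqr gtr0_norm.
  apply: (@continuous_comp _ _ _ (fun y : R => (x + k * y) / Num.sqrt (y ^+ 2 ^+ 2 + v))
    (@Phi R)); last exact: Phi_continuous.
  apply: cvgM.
    by apply: cvgD; [exact: cvg_cst|apply: cvgMl_tmp; exact: cvg_id].
  apply: cvgV.
    by rewrite !expr0n/= add0r vE sqrtr_sqr normr_eq0 gt_eqF.
  apply: (@continuous_comp _ _ _ (fun y : R => y ^+ 2 ^+ 2 + v) Num.sqrt);
    last exact: sqrt_continuous.
  apply: cvgD; last exact: cvg_cst.
  by apply: (@continuous_comp _ _ _ (fun y : R => y ^+ 2) (fun y : R => y ^+ 2));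
    exact: exprn_continuous.
apply/cvgrPdist_le => eta eta0.
have eta4 : 0 < eta / 4 by rewrite divr_gt0.
have [M M0 hM] := Phi_tail eta4.
have lo := scale (- 1); have hi := scale 1.
move: lo hi => /cvgrPdist_le/(_ _ eta4) lo /cvgrPdist_le/(_ _ eta4) hi.
near (0 : R)^'+ => y.
have y0 : 0 < y by near: y; exact: nbhs_right_gt.
have yM : y <= M^-1 by near: y; apply: nbhs_right_le; rewrite invr_gt0.
have y20 : 0 < y ^+ 2 ^+ 2 by rewrite !exprn_gt0.
have := smooth_le x y y20 eta4; apply: filterS => n.
have -> : y / Num.sqrt (y ^+ 2 ^+ 2) = y^-1.
  rewrite sqrtr_sqr ger0_norm ?sqr_ge0//.
  by field; rewrite gt_eqF.
have tail : 1 - Phi y^-1 <= eta / 4.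
  apply: le_trans hM; rewrite lerB//; apply: Phi_ler.
  by rewrite -[M]invrK lef_pV2// posrE ?invr_gt0.
have : `|Phi (x / sigma) - Phi ((x + -1 * y) / Num.sqrt (y ^+ 2 ^+ 2 + v))| <= eta / 4.
  by near: y.
have : `|Phi (x / sigma) - Phi ((x + 1 * y) / Num.sqrt (y ^+ 2 ^+ 2 + v))| <= eta / 4.
  by near: y.
rewrite mulN1r mul1r !ler_norml => /andP[h1 h2] /andP[h3 h4] /andP[h5 h6].
by apply/andP; split; lra.
Unshelve. all: by end_near. Qed.

End smoothing.

(** * The central limit theorem *)

Section iid.
Context {R : realType} {d : measure_display} {T : measurableType d}.
Context (P : probability T R) {d' : measure_display} {S : measurableType d'}.
Context (Z : {RV P >-> S}) (Zs : nat -> {RV P >-> S}) (phi : S -> R) (v : R).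
Hypothesis Zs_iid : iid_copies Z Zs.
Hypothesis mphi : measurable_fun setT phi.
Hypothesis iphi : P.-integrable setT (EFin \o (fun w => phi (Z w))).
Hypothesis iphi2 : P.-integrable setT (EFin \o (fun w => phi (Z w) ^+ 2)).
Hypothesis Ephi : \int[P]_w phi (Z w) = 0.
Hypothesis Ephi2 : \int[P]_w (phi (Z w) ^+ 2) = v.

Let mean n w : R := n%:R^-1 * \sum_(i < n) phi (Zs i w).

Let sqrt_mean n w :
  Num.sqrt n%:R * mean n w = (Num.sqrt n%:R)^-1 * \sum_(i < n) phi (Zs i w).
Proof.
rewrite mulrA; congr (_ * _); case: n => [|n]; first by rewrite sqrtr0 mul0r invr0.
have N0 : Num.sqrt n.+1%:R != 0 :> R by rewrite gt_eqF// sqrtr_gt0.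
rewrite -{2}[n.+1%:R](@sqr_sqrtr R)//.
by field.
Qed.

Let mphiZ (X : {RV P >-> S}) : measurable_fun setT (phi \o X).
Proof. exact: measurableT_comp. Qed.

Let msqrt_mean n : measurable_fun setT (fun w => Num.sqrt n%:R * mean n w).
Proof.
apply: measurable_funM => //; apply: measurable_funM => //.
by apply: measurable_sum => i; exact: mphiZ.
Qed.

Let smooth_mean a e : 0 < e ->
  (\int[P]_w heat a e (Num.sqrt n%:R * mean n w)) @[n --> \oo] -->
  heat a (e + v) 0.
Proof.
move=> e0.
rewrite (_ : (fun n => _) = fun n : nat => \int[P]_w heat a e
    ((Num.sqrt n%:R)^-1 * \sum_(i < n) phi (Zs i w))); last first.
  by apply/funext => n; apply: eq_Rintegral => w _; rewrite sqrt_mean.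
apply: (@lindeberg_cvg _ _ _ P (fun i => phi \o Zs i) (phi \o Z) v) => //.
- by move=> k A B mA mB; exact: (independent_partial_sum Zs_iid.1).
- move=> i A mA; have mphiA : measurable (phi @^-1` A).
    by rewrite -[X in measurable X]setTI; exact: mphi.
  exact: (Zs_iid.2 i _ mphiA).
Qed.

(** Unlike in [central_limit], the variance may be zero: this serves for the
    abscissas too. *)
Lemma iid_tight eta : 0 < eta -> exists2 M, 0 < M &
  \forall n \near \oo, fine (P [set w | M < `|Num.sqrt n%:R * mean n w|]) <= eta.
Proof.
have v0 : 0 <= v by rewrite -Ephi2; apply: Rintegral_ge0 => w _; exact: sqr_ge0.
by apply: (smooth_tight msqrt_mean v0) => a e; exact: smooth_mean.
Qed.

Theorem central_limit sigma k : 0 < sigma -> v = sigma ^+ 2 ->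
  fine (P [set w | Num.sqrt n%:R * mean n w <= k]) @[n --> \oo] -->
  Phi (k / sigma).
Proof.
move=> s0 vE; apply: (smooth_cvg_le msqrt_mean _ s0 vE) => a e.
exact: smooth_mean.
Qed.

End iid.

(** * Nearest points of a curve given by its radius *)

Section trigonometric_bounds.
Context {R : realType}.
Implicit Types s t : R.

Lemma sin_le_id t : 0 <= t -> sin t <= t.
Proof.
move=> t0; have [|c _] := MVT_segment t0 (fun x _ => is_derive_sin x).
  by apply: continuous_subspaceT => x; exact: continuous_sin.
by rewrite sin0 !subr0 => ->; rewrite ler_piMl// cos_le1.
Qed.

Lemma cosB_bound s t : 0 <= s -> s <= t -> t <= 1 ->
  0 <= cos s - cos t <= t * (t - s).
Proof.
move=> s0 st t1; have [|c] := MVT_segment st (fun x _ => is_derive_cos x).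
  by apply: continuous_subspaceT => x; exact: continuous_cos.
rewrite in_itv/= => /andP[sc ct] E.
have c0 : 0 <= c := le_trans s0 sc.
have -> : cos s - cos t = sin c * (t - s) by rewrite -[LHS]opprB E mulNr opprK.
have sinc : 0 <= sin c.
  by apply: sin_ge0_pi; rewrite c0/=; have := @pi_ge2 R; lra.
rewrite mulr_ge0 ?subr_ge0//= ler_wpM2r ?subr_ge0//.
exact: le_trans (sin_le_id c0) ct.
Qed.

Lemma cos_ge s : 0 <= s -> s <= 1 -> 1 - s ^+ 2 <= cos s.
Proof.
by move=> s0 s1; have := cosB_bound (lexx 0) s0 s1; rewrite cos0 subr0; lra.
Qed.

Lemma sinB_bound s t : 0 <= s -> s <= t -> t <= 1 ->
  (1 - t ^+ 2) * (t - s) <= sin t - sin s <= t - s.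
Proof.
move=> s0 st t1; have [|c] := MVT_segment st (fun x _ => is_derive_sin x).
  by apply: continuous_subspaceT => x; exact: continuous_sin.
rewrite in_itv/= => /andP[sc ct] ->.
have c0 : 0 <= c := le_trans s0 sc.
rewrite ler_wpM2r ?subr_ge0//=.
  by rewrite -[leRHS]mul1r ler_wpM2r ?subr_ge0// cos_le1.
apply: le_trans (cos_ge c0 (le_trans ct t1)).
by rewrite lerD2l lerN2 lerXn2r// nnegrE (le_trans c0).
Qed.

End trigonometric_bounds.

Section nearest_point.
Context {R : realType}.
Implicit Types x y s t e : R.

(* [g] stands for the derivative of the radius [r]. It is increasing, which
   enters through the two-sided bound on the increments of [r], so that no
   derivative has to be taken. *)
Context (B : R) (r g : R -> R).
Hypothesis B_gt0 : 0 < B.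
Hypothesis r0 : r 0 = 1.
Hypothesis g_ge0 : forall t, 0 <= t <= B -> 0 <= g t.
Hypothesis g_gt0 : forall t, 0 < t <= B -> 0 < g t.
Hypothesis r_increment : forall s t, 0 <= s -> s <= t -> t <= B ->
  g s * (t - s) <= r t - r s <= g t * (t - s).

(** The squared distance from [(x, y)] to the point of the curve with
    parameter [t], up to the constant [x ^+ 2 + y ^+ 2]. *)
Definition distance_cost x y t : R :=
  r `|t| ^+ 2 - 2 * r `|t| * (x * cos t + y * sin t).

Definition nearest x y t : Prop :=
  `|t| <= B /\ forall s, `|s| <= B -> distance_cost x y t <= distance_cost x y s.

Lemma nearest_opp x y t : nearest x y t -> nearest x (- y) (- t).
Proof.
have costN s : distance_cost x (- y) s = distance_cost x y (- s).
  by rewrite /distance_cost normrN cosN sinN mulNr mulrN.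
case=> tB tmin; split=> [|s sB]; first by rewrite normrN.
by rewrite !costN opprK; apply: tmin; rewrite normrN.
Qed.

Lemma radius_homo s t : 0 <= s -> s <= t -> t <= B -> r s <= r t.
Proof.
move=> s0 st tB; have /andP[+ _] := r_increment s0 st tB.
rewrite -[_ <= r t]subr_ge0; apply: le_trans.
by rewrite mulr_ge0 ?subr_ge0// g_ge0// s0 (le_trans st).
Qed.

Lemma radius_ge1 t : 0 <= t <= B -> 1 <= r t.
Proof. by case/andP=> t0 tB; rewrite -r0 radius_homo. Qed.

Lemma radius_gt1 t : 0 < t <= B -> 1 < r t.
Proof.
case/andP=> t0 tB; have t20 : 0 < t / 2 by rewrite divr_gt0.
have t2B : t / 2 <= t by lra.
have /andP[h _] := r_increment (ltW t20) t2B tB.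
have g0 : 0 < g (t / 2) by rewrite g_gt0// t20 (le_trans t2B).
have := radius_ge1 (t := t / 2); rewrite (ltW t20) (le_trans t2B tB) => /(_ isT).
have : 0 < g (t / 2) * (t - t / 2) by rewrite mulr_gt0//; lra.
lra.
Qed.

Lemma radius_le t : 0 <= t <= B -> r t <= 1 + g t * t.
Proof.
by case/andP=> t0 tB; have := r_increment (lexx 0) t0 tB; rewrite r0 subr0; lra.
Qed.

(** Compare with the tip [t = 0], the unique point of the curve at distance
    one from the origin. *)
Lemma nearest_small s : 0 < s <= B -> exists2 e, 0 < e &
  forall x y t, `|x| <= e -> `|y| <= e -> nearest x y t -> `|t| < s.
Proof.
move=> sB; have rs := radius_gt1 sB; case/andP: sB => s0 sB.
exists ((r s - 1) / 7) => [|x y t]; first by rewrite divr_gt0// subr_gt0.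
set e := (r s - 1) / 7 => xe ye [tB tmin].
have e0 : 0 < e by rewrite divr_gt0// subr_gt0.
rewrite ltNge; apply/negP => st.
have rst : r s <= r `|t| by rewrite radius_homo// ltW.
have := tmin 0; rewrite /distance_cost normr0 ltW// r0 cos0 sin0 => /(_ isT).
set q := r `|t| in rst *.
have xc : x * cos t <= e.
  apply: le_trans xe; apply: (le_trans (ler_norm _)); rewrite normrM ler_piMr//.
  by rewrite ler_norml cos_geN1 cos_le1.
have ysn : y * sin t <= e.
  apply: le_trans ye; apply: (le_trans (ler_norm _)); rewrite normrM ler_piMr//.
  by rewrite ler_norml sin_geN1 sin_le1.
have xe' : - e <= x by move: xe; rewrite ler_norml => /andP[].
(* the two costs give [q ^+ 2 - 1 <= 4 * q * e + 2 * e], too small for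
   [7 * e <= q - 1] *)
have eE : r s = 1 + 7 * e by rewrite /e; field.
nra.
Qed.

(** Reflecting the parameter keeps the radius and changes the sign of the
    product of [y] and the sine. *)
Lemma nearest_sign x y t : 0 < y -> `|t| <= 1 -> nearest x y t -> 0 <= t.
Proof.
move=> y0 t1 [tB tmin]; rewrite leNgt; apply/negP => t0.
have := tmin (- t); rewrite normrN => /(_ tB).
rewrite /distance_cost normrN cosN sinN.
have sint : sin t < 0.
  rewrite -oppr_gt0 -sinN; apply: sin_gt0_pi.
  by move: t1; rewrite ltr0_norm// => t1; have := @pi_ge2 R; lra.
have rt : 1 <= r `|t| by rewrite radius_ge1// normr_ge0.
have : r `|t| * (y * sin t) < 0.
  by rewrite pmulr_rlt0 ?(lt_le_trans _ rt)// pmulr_rlt0.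
lra.
Qed.

(** If the nearest point lies before [s], moving to [s] must not pay off. Per
    unit of parameter the move gains almost [y] from the sine, and it loses at
    most [g s] from the radius and [`|x| * s] from the cosine, up to factors
    close to 1. *)
Lemma nearest_lt x y s t e : 0 < s -> s <= B -> s <= 1 -> 0 <= e ->
  `|x| <= e -> `|y| <= e -> `|t| <= 1 -> nearest x y t -> t < s ->
  y * (1 - s ^+ 2) <= g s * (r s + 2 * e) + `|x| * s.
Proof.
move=> s0 sB s1 e0 xe ye t1 tn ts.
have gs0 : 0 <= g s by rewrite g_ge0// (ltW s0).
have rs1 : 1 <= r s by rewrite radius_ge1// (ltW s0).
have rhs0 : 0 <= g s * (r s + 2 * e) + `|x| * s.
  by rewrite addr_ge0 ?mulr_ge0// ?(ltW s0)//; lra.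
have [y0|y0] := leP y 0; first by apply: le_trans rhs0; rewrite mulr_le0_ge0//; nra.
have t0 := nearest_sign y0 t1 tn.
case: tn => tB /(_ s); rewrite (gtr0_norm s0) => /(_ sB).
rewrite /distance_cost (gtr0_norm s0) (ger0_norm t0) => H.
have /andP[rl ru] := r_increment t0 (ltW ts) sB.
have /andP[c1 c2] := cosB_bound t0 (ltW ts) s1.
have /andP[d1 d2] := sinB_bound t0 (ltW ts) s1.
have rt1 : 1 <= r t by rewrite radius_ge1// t0 (le_trans (ltW ts)).
have gt0 : 0 <= g t by rewrite g_ge0// t0 (le_trans (ltW ts)).
have rts : r t <= r s by rewrite radius_homo// ltW.
set D := s - t in rl ru c1 c2 d1 d2; have D0 : 0 < D by rewrite subr_gt0.
rewrite -(ler_pM2r D0).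
have xcs : `|x * cos s| <= e.
  by rewrite normrM (le_trans _ xe)// ler_piMr// ler_norml cos_geN1 cos_le1.
have yss : `|y * sin s| <= e.
  by rewrite normrM (le_trans _ ye)// ler_piMr// ler_norml sin_geN1 sin_le1.
have xcs' : - e <= x * cos s by move: xcs; rewrite ler_norml => /andP[].
have yss' : - e <= y * sin s by move: yss; rewrite ler_norml => /andP[].
(* comparison of the two costs, factored through the increments *)
have H1 : 2 * r t * (x * (cos s - cos t) + y * (sin s - sin t)) <=
    (r s - r t) * (r s + r t - 2 * (x * cos s + y * sin s)) by nra.
have xcc : - (`|x| * (s * D)) <= x * (cos s - cos t).
  rewrite -[x * _]opprK lerN2 -mulrN opprB.
  apply: (le_trans (ler_norm _)); rewrite normrM (ger0_norm c1).
  by rewrite ler_wpM2l.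
have ysn : y * ((1 - s ^+ 2) * D) <= y * (sin s - sin t) by rewrite ler_pM2l.
have H2 : (r s - r t) * (r s + r t - 2 * (x * cos s + y * sin s)) <=
    g s * D * (2 * r s + 4 * e).
  apply: (@le_trans _ _ ((r s - r t) * (2 * r s + 4 * e))).
    by rewrite ler_wpM2l ?subr_ge0//; lra.
  by rewrite ler_wpM2r//; lra.
set L := x * (cos s - cos t) + y * (sin s - sin t) in H1.
have H3 : 2 * r t * L <= g s * D * (2 * r s + 4 * e) by exact: le_trans H2.
have [L0|L0] := leP L 0.
  apply: (@le_trans _ _ (`|x| * s * D)); last first.
    rewrite ler_wpM2r ?(ltW D0)// lerDr mulr_ge0//; lra.
  rewrite /L in L0; lra.
have H4 : 2 * L <= 2 * r t * L by rewrite ler_pM2r//; lra.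
rewrite /L in H3 H4; lra.
Qed.

(** If it lies beyond [s], moving back to [s] must not pay off: the balance of
    [nearest_lt] with all signs reversed. *)
Lemma nearest_gt x y s t e : 0 < s -> s < t -> t <= 1 -> e <= 1 / 2 ->
  `|x| <= e -> `|y| <= e -> nearest x y t ->
  g s * (1 - 2 * e) <= r s * (`|x| * t + y).
Proof.
move=> s0 st t1 e1 xe ye tn; have t0 : 0 < t := lt_trans s0 st.
have e0 : 0 <= e := le_trans (normr_ge0 x) xe.
have y0 : 0 <= y.
  rewrite leNgt; apply/negP => y0.
  have yN : 0 < - y by rewrite oppr_gt0.
  have tN : `|- t| <= 1 by rewrite normrN (gtr0_norm t0).
  by have := nearest_sign yN tN (nearest_opp tn); rewrite oppr_ge0 leNgt t0.
case: tn => tB /(_ s); rewrite (gtr0_norm t0) in tB.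
have sB : s <= B := le_trans (ltW st) tB.
rewrite (gtr0_norm s0) => /(_ sB).
rewrite /distance_cost (gtr0_norm s0) (gtr0_norm t0) => H.
have /andP[rl ru] := r_increment (ltW s0) (ltW st) tB.
have /andP[c1 c2] := cosB_bound (ltW s0) (ltW st) t1.
have /andP[d1 d2] := sinB_bound (ltW s0) (ltW st) t1.
have gs0 : 0 <= g s by rewrite g_ge0// (ltW s0).
have rs1 : 1 <= r s by rewrite radius_ge1// (ltW s0).
have rt1 : 1 <= r t by rewrite radius_ge1// (ltW t0).
set D := t - s in rl ru c1 c2 d1 d2; have D0 : 0 < D by rewrite subr_gt0.
rewrite -(ler_pM2r D0).
have xct : x * cos t <= e.
  apply: le_trans xe; apply: (le_trans (ler_norm _)); rewrite normrM ler_piMr//.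
  by rewrite ler_norml cos_geN1 cos_le1.
have yst : y * sin t <= e.
  apply: le_trans ye; apply: (le_trans (ler_norm _)); rewrite normrM ler_piMr//.
  by rewrite ler_norml sin_geN1 sin_le1.
have H1 : (r t - r s) * (r t + r s - 2 * (x * cos t + y * sin t)) <=
    2 * r s * (x * (cos t - cos s) + y * (sin t - sin s)) by nra.
have H2 : g s * D * (2 - 4 * e) <=
    (r t - r s) * (r t + r s - 2 * (x * cos t + y * sin t)).
  apply: ler_pM => //; [by rewrite mulr_ge0// ltW|by lra|by lra].
have xcc : x * (cos t - cos s) <= `|x| * (t * D).
  apply: (le_trans (ler_norm _)); rewrite normrM distrC (ger0_norm c1).
  by rewrite ler_wpM2l.
have ysn : y * (sin t - sin s) <= y * D by rewrite ler_wpM2l.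
have H3 : 2 * r s * (x * (cos t - cos s) + y * (sin t - sin s)) <=
    2 * r s * (`|x| * (t * D) + y * D).
  by rewrite ler_wpM2l ?lerD// mulr_ge0//; lra.
have := le_trans H2 (le_trans H1 H3); lra.
Qed.

Context (G : R).
Hypothesis g_le : forall t, 0 <= t <= B -> g t <= G.

Section asymptotics.
Context (a : nat -> R).
Hypothesis a_cvgy : a n @[n --> \oo] --> +oo.

Let shrink u e : 0 < u -> 0 < e -> \forall n \near \oo, 0 < u / a n <= e.
Proof.
move=> u0 e0; near=> n.
have an : 0 < a n by near: n; exact: cvgry_gt.
rewrite divr_gt0//= ler_pdivrMr// mulrC -ler_pdivrMr//.
by near: n; exact: cvgry_ge.
Unshelve. all: by end_near. Qed.

Let shrink_sqrt M e : 0 < e -> \forall n \near \oo, M / Num.sqrt n%:R <= e.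
Proof.
move=> e0; have : M / Num.sqrt n%:R @[n --> \oo] --> (0 : R).
  by rewrite -[X in _ --> X](mulr0 M); apply: cvgMl_tmp; exact: inv_sqrtn_cvg0.
by move=> h; exact: (cvgr_le _ h).
Qed.

Let sqrt_gt0 : \forall n \near \oo, 0 < Num.sqrt n%:R :> R.
Proof. by near=> n; rewrite sqrtr_gt0 ltr0n; near: n; exists 1%N.
Unshelve. all: by end_near. Qed.

Let radius_small e : 0 < e -> exists2 s, 0 < s & forall t, 0 < t <= s ->
  [/\ t <= B, t <= 1 & r t <= 1 + e].
Proof.
move=> e0; have G0 : 0 <= G.
  by apply: le_trans (g_le (t := 0) _); rewrite ?g_ge0// lexx ltW.
exists (Num.min (Num.min B 1) (e / (G + 1))).
  by rewrite !lt_min B_gt0 ltr01 divr_gt0// ltr_wpDl.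
move=> t /andP[t0]; rewrite !le_min => /andP[/andP[tB t1] te]; split=> //.
have t0B : 0 <= t <= B by rewrite ltW.
apply: (le_trans (radius_le t0B)); rewrite lerD2l.
have := g_le t0B; have := g_ge0 t0B; move: te; rewrite ler_pdivlMr ?ltr_wpDl//.
nra.
Qed.

Let nearest_local M s : 0 < s -> \forall n \near \oo, forall x y t,
  `|Num.sqrt n%:R * x| <= M -> `|Num.sqrt n%:R * y| <= M -> nearest x y t ->
  `|t| < s.
Proof.
move=> s0; pose s' := Num.min s B.
have s'B : 0 < s' <= B by rewrite lt_min s0 B_gt0/= ge_min lexx orbT.
have [e e0 small] := nearest_small s'B.
near=> n => x y t.
have N0 : 0 < Num.sqrt n%:R :> R by near: n; exact: sqrt_gt0.
rewrite !normrM (gtr0_norm N0) => xM yM /small tmin.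
have Ne : M / Num.sqrt n%:R <= e by near: n; exact: shrink_sqrt.
have zle (z : R) : Num.sqrt n%:R * `|z| <= M -> `|z| <= e.
  by move=> zM; apply: le_trans Ne; rewrite ler_pdivlMr// mulrC.
have := tmin (zle x xM) (zle y yM); move=> /lt_le_trans; apply.
by rewrite ge_min lexx.
Unshelve. all: by end_near. Qed.

(** For [x] and [y] of order [(Num.sqrt n%:R)^-1] the inequality of [nearest_gt],
    multiplied by [Num.sqrt n%:R], retains only the scaled slope and the scaled
    ordinate: the parameters are small by [nearest_local], and all other terms
    carry a vanishing factor. *)
Lemma nearest_gt_near M k e u : 0 < M -> 0 <= k -> 0 < e -> 0 < u ->
  (\forall n \near \oo, k <= Num.sqrt n%:R * g (u / a n)) ->
  \forall n \near \oo, forall x y t,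
    `|Num.sqrt n%:R * x| <= M -> `|Num.sqrt n%:R * y| <= M -> nearest x y t ->
    u / a n < t -> k - e <= Num.sqrt n%:R * y.
Proof.
move=> M0 k0 e0 u0 kg.
pose d := Num.min (1 / 2) (e / (6 * (k + 1))).
have k1 : 0 < 6 * (k + 1) by rewrite mulr_gt0// ltr_wpDl.
have d0 : 0 < d by rewrite lt_min !divr_gt0.
have d12 : d <= 1 / 2 by rewrite ge_min lexx.
have dk : 6 * (d * (k + 1)) <= e.
  rewrite mulrCA -ler_pdivlMr//.
  by rewrite ge_min lexx orbT.
have [s1 s10 small] := radius_small d0.
pose s0 := Num.min 1 (e / (2 * M)).
have s00 : 0 < s0 by rewrite lt_min ltr01 divr_gt0// mulr_gt0.
have s0M : 2 * (M * s0) <= e.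
  by rewrite mulrA mulrC -ler_pdivlMr ?mulr_gt0// ge_min lexx orbT.
near=> n => x y t xM yM tn st.
have N0 : 0 < Num.sqrt n%:R :> R by near: n; exact: sqrt_gt0.
have sn : 0 < u / a n <= s1 by near: n; exact: shrink.
have [sB sn1 rs] := small _ sn.
have Ne : M / Num.sqrt n%:R <= d by near: n; exact: shrink_sqrt.
have kgn : k <= Num.sqrt n%:R * g (u / a n) by near: n.
have ts0 : `|t| < s0.
  by move: x y t xM yM tn {st}; near: n; exact: nearest_local.
set N := Num.sqrt n%:R in N0 Ne kgn xM yM *; set s := u / a n in sn sB sn1 rs kgn st.
case/andP: sn => sn0 _.
have t0 : 0 < t := lt_trans sn0 st.
rewrite (gtr0_norm t0) in ts0.
have t1 : t <= 1 by apply: (le_trans (ltW ts0)); rewrite ge_min lexx.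
have ed (z : R) : `|N * z| <= M -> `|z| <= d.
  rewrite normrM (gtr0_norm N0) => zM; apply: le_trans Ne.
  by rewrite ler_pdivlMr// mulrC.
have H := nearest_gt sn0 st t1 d12 (ed _ xM) (ed _ yM) tn.
have gs0 : 0 <= g s by rewrite g_ge0// (ltW sn0).
have rs1 : 1 <= r s by rewrite radius_ge1// (ltW sn0).
have Nx : N * `|x| * t <= M * s0.
  apply: ler_pM => //; [by rewrite mulr_ge0// ltW|exact: ltW| |exact: ltW].
  by move: xM; rewrite normrM (gtr0_norm N0).
have H2 : k * (1 - 2 * d) <= r s * (M * s0 + N * y).
  apply: (@le_trans _ _ (N * g s * (1 - 2 * d))).
    by rewrite ler_wpM2r//; lra.
  apply: (@le_trans _ _ (N * (r s * (`|x| * t + y)))).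
    by rewrite -mulrA ler_wpM2l// ltW.
  rewrite mulrCA ler_wpM2l//; first by lra.
  by rewrite mulrDr lerD2r mulrA.
set Z := M * s0 + N * y in H2.
have Z0 : 0 <= Z.
  have : 0 <= r s * Z by apply: le_trans H2; rewrite mulr_ge0//; lra.
  by rewrite pmulr_rge0// (lt_le_trans ltr01).
have H3 : k * (1 - 2 * d) <= (1 + d) * Z.
  by apply: (le_trans H2); rewrite ler_wpM2r.
have : k - e / 2 <= Z.
  rewrite leNgt; apply/negP => Zk; nra.
rewrite /Z; lra.
Unshelve. all: by end_near. Qed.

Lemma nearest_lt_near M k e u : 0 < M -> 0 <= k -> 0 < e -> 0 < u ->
  (\forall n \near \oo, Num.sqrt n%:R * g (u / a n) <= k) ->
  \forall n \near \oo, forall x y t,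
    `|Num.sqrt n%:R * x| <= M -> `|Num.sqrt n%:R * y| <= M -> nearest x y t ->
    t < u / a n -> Num.sqrt n%:R * y <= k + e.
Proof.
move=> M0 k0 e0 u0 kg.
pose d := Num.min (1 / 2) (e / (6 * (k + 1))).
have k1 : 0 < 6 * (k + 1) by rewrite mulr_gt0// ltr_wpDl.
have d0 : 0 < d by rewrite lt_min !divr_gt0.
have dk : 6 * (d * (k + 1)) <= e.
  rewrite mulrCA -ler_pdivlMr//.
  by rewrite ge_min lexx orbT.
have [s1 s10 small] := radius_small d0.
pose s0 := Num.min 1 (e / (4 * M)).
have s00 : 0 < s0 by rewrite lt_min ltr01 divr_gt0// mulr_gt0.
have s0M : 4 * (M * s0) <= e.
  by rewrite mulrA mulrC -ler_pdivlMr ?mulr_gt0// ge_min lexx orbT.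
near=> n => x y t xM yM tn st.
have N0 : 0 < Num.sqrt n%:R :> R by near: n; exact: sqrt_gt0.
have sn : 0 < u / a n <= s1 by near: n; exact: shrink.
have sns0 : 0 < u / a n <= s0 by near: n; exact: shrink.
have [sB sn1 rs] := small _ sn.
have Ne : M / Num.sqrt n%:R <= d by near: n; exact: shrink_sqrt.
have kgn : Num.sqrt n%:R * g (u / a n) <= k by near: n.
have t1 : `|t| <= 1.
  apply: ltW; move: x y t xM yM tn {st}; near: n; exact: nearest_local.
set N := Num.sqrt n%:R in N0 Ne kgn xM yM *.
set s := u / a n in sn sns0 sB sn1 rs kgn st.
case/andP: sn => sn0 _; case/andP: sns0 => _ ss0.
have ed (z : R) : `|N * z| <= M -> `|z| <= d.
  rewrite normrM (gtr0_norm N0) => zM; apply: le_trans Ne.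
  by rewrite ler_pdivlMr// mulrC.
have H := nearest_lt sn0 sB sn1 (ltW d0) (ed _ xM) (ed _ yM) t1 tn st.
have gs0 : 0 <= g s by rewrite g_ge0// (ltW sn0).
have rs1 : 1 <= r s by rewrite radius_ge1// (ltW sn0).
have NH : N * (y * (1 - s ^+ 2)) <= N * (g s * (r s + 2 * d) + `|x| * s).
  by rewrite ler_wpM2l// ltW.
have Ngr : N * g s * (r s + 2 * d) <= k * (1 + 3 * d).
  by apply: ler_pM => //; [rewrite mulr_ge0// ltW|lra|lra].
have Nxs : N * `|x| * s <= M * s0.
  apply: ler_pM => //; [by rewrite mulr_ge0// ltW|exact: ltW|].
  by move: xM; rewrite normrM (gtr0_norm N0).
have Nys : N * y * s ^+ 2 <= M * s0.
  apply: (le_trans (ler_norm _)); rewrite normrM.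
  apply: ler_pM => //; rewrite ger0_norm ?sqr_ge0//; nra.
have dk' : 3 * (k * d) <= e / 2 by nra.
lra.
Unshelve. all: by end_near. Qed.

Section tails.
Context {d : measure_display} {T : measurableType d} (P : probability T R).
Context (x y t tau : nat -> T -> R) (sigma : R).
Hypothesis mx : forall n, measurable_fun setT (x n).
Hypothesis my : forall n, measurable_fun setT (y n).
Hypothesis mtau : forall n, measurable_fun setT (tau n).
Hypothesis tight_x : forall e, 0 < e -> exists2 M, 0 < M &
  \forall n \near \oo, fine (P [set w | M < `|Num.sqrt n%:R * x n w|]) <= e.
Hypothesis tight_y : forall e, 0 < e -> exists2 M, 0 < M &
  \forall n \near \oo, fine (P [set w | M < `|Num.sqrt n%:R * y n w|]) <= e.
Hypothesis clt_y : forall k,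
  fine (P [set w | Num.sqrt n%:R * y n w <= k]) @[n --> \oo] --> Phi (k / sigma).
Hypothesis nearest_t : forall n w, (0 < n)%N -> nearest (x n w) (y n w) (t n w).
(* [tau] is the parameter itself or the ordinate of the nearest point. *)
Hypothesis tau_t : forall e, 0 < e -> exists2 s, 0 < s &
  forall n w, (0 < n)%N -> `|t n w| <= s -> `|tau n w - t n w| <= e * `|t n w|.

Local Notation Pr A := (fine (P A)).

Let mscaled (z : nat -> T -> R) n : measurable_fun setT (z n) ->
  measurable_fun setT (fun w => Num.sqrt n%:R * z n w).
Proof. by move=> mz; exact: measurable_funM. Qed.

Let matau n : measurable_fun setT (fun w => a n * tau n w).
Proof. exact: measurable_funM. Qed.

Let matau_ge n u : measurable [set w | u <= a n * tau n w].
Proof. exact: measurable_ge. Qed.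

Let matau_gt n u : measurable [set w | u < a n * tau n w].
Proof. exact: measurable_gt. Qed.

Let far M n : set T := [set w | M < `|Num.sqrt n%:R * x n w|] `|`
  [set w | M < `|Num.sqrt n%:R * y n w|].

Let measurable_far M n : measurable (far M n).
Proof.
by apply: measurableU; apply: measurable_norm_gt; exact: mscaled.
Qed.

Let far_small e : 0 < e -> exists2 M, 0 < M &
  \forall n \near \oo, Pr (far M n) <= e.
Proof.
move=> e0; have e20 : 0 < e / 2 by rewrite divr_gt0.
have [M1 M10 h1] := tight_x e20; have [M2 M20 h2] := tight_y e20.
exists (M1 + M2); first exact: addr_gt0.
near=> n.
have mX M := measurable_norm_gt M (mscaled (mx n)).
have mY M := measurable_norm_gt M (mscaled (my n)).
apply: (le_trans (fine_probabilityU P (mX _) (mY _))).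
have l1 : Pr [set w | M1 < `|Num.sqrt n%:R * x n w|] <= e / 2 by near: n.
have l2 : Pr [set w | M2 < `|Num.sqrt n%:R * y n w|] <= e / 2 by near: n.
have -> : e = e / 2 + e / 2 by lra.
apply: lerD; [apply: le_trans l1|apply: le_trans l2].
- apply: le_fine_probability; [exact: mX|exact: mX|move=> w /=].
  by apply: le_lt_trans; rewrite lerDl ltW.
- apply: le_fine_probability; [exact: mY|exact: mY|move=> w /=].
  by apply: le_lt_trans; rewrite lerDr ltW.
Unshelve. all: by end_near. Qed.

Let Phi_modulus k e : 0 < e -> exists2 h, 0 < h &
  Phi (k / sigma) - e <= Phi ((k - h) / sigma) /\
  Phi ((k + h) / sigma) <= Phi (k / sigma) + e.
Proof.
move=> e0.
have c : Phi (z / sigma) @[z --> k] --> Phi (k / sigma).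
  apply: (@continuous_comp _ _ _ (fun z : R => z / sigma) (@Phi R)).
    by apply: cvgMr_tmp; exact: cvg_id.
  exact: Phi_continuous.
move/cvgrPdist_le : c => /(_ _ e0) /nbhs_ballP[h /= h0 hk].
exists (h / 2); first by rewrite divr_gt0.
have bk (z : R) : `|k - z| <= h / 2 -> `|Phi (k / sigma) - Phi (z / sigma)| <= e.
  move=> kz; apply: hk; rewrite /ball/=; apply: (le_lt_trans kz).
  by rewrite ltr_pdivrMr// ltr_pMr// ltr1n.
have h20 : 0 <= h / 2 by rewrite divr_ge0// ltW.
split.
- have := bk (k - h / 2); rewrite opprB addrC subrK ger0_norm// lexx => /(_ isT).
  by rewrite ler_norml => /andP[_]; lra.
- have := bk (k + h / 2); rewrite opprD addrA subrr add0r normrN ger0_norm// lexx.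
  by move=> /(_ isT); rewrite ler_norml => /andP[]; lra.
Qed.

(** If [tau] is large, then so is [t], and [nearest_gt_near] forces the scaled
    ordinate above [k], unless the sample mean is exceptionally far away. *)
Lemma tail_upper k e u u0 : 0 < u < u0 -> 0 <= k -> 0 < e ->
  (\forall n \near \oo, k <= Num.sqrt n%:R * g (u / a n)) ->
  \forall n \near \oo, Pr [set w | u0 <= a n * tau n w] <= 1 - Phi (k / sigma) + e.
Proof.
move=> /andP[u_gt0 uu0] k0 e0 kg.
have e40 : 0 < e / 4 by rewrite divr_gt0.
have [M M0 farM] := far_small e40.
have [h h0 [hk _]] := Phi_modulus k e40.
have h20 : 0 < h / 2 by rewrite divr_gt0.
(* the room between [u] and [u0] for the relative error of [tau] *)
pose q := (u0 - u) / (2 * u).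
have q0 : 0 < q by rewrite divr_gt0 ?subr_gt0// mulr_gt0.
have qu : (1 + q) * u < u0.
  by have -> : (1 + q) * u = (u + u0) / 2; [rewrite /q; field; rewrite gt_eqF|lra].
have q20 : 0 < Num.min q (1 / 2) by rewrite lt_min q0/=.
have [s s_gt0 taus] := tau_t q20.
near=> n.
have n0 : (0 < n)%N by near: n; exists 1%N.
have an0 : 0 < a n by near: n; exact: cvgry_gt.
have Y : Phi ((k - h) / sigma) - e / 4 <= Pr [set w | Num.sqrt n%:R * y n w <= k - h].
  near: n; have := @clt_y (k - h); move=> /cvgr_ge; apply.
  by rewrite ltrBlDr ltrDl.
have mY := measurable_le (k - h) (mscaled (my n)).
apply: (@le_trans _ _ (Pr (far M n `|`
    ~` [set w | Num.sqrt n%:R * y n w <= k - h]))).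
  apply: le_fine_probability => //; first by apply: measurableU => //; exact: measurableC.
  move=> w /= u0w; have [|/not_orP[/= /negP + /negP]] := pselect (far M n w); first by left.
  rewrite -!leNgt => xM yM; right=> /= yk.
  have tn := nearest_t w n0.
  have ts : `|t n w| <= s.
    apply: ltW; move: (x n w) (y n w) (t n w) xM yM tn; near: n.
    exact: nearest_local.
  have tt := taus n w n0 ts.
  have tau0 : 0 < tau n w by rewrite -(pmulr_rgt0 _ an0) (lt_le_trans _ u0w)// (lt_trans u_gt0).
  have t0 : 0 < t n w.
    rewrite ltNge; apply/negP => t0.
    move: tt; rewrite (ler0_norm t0) => /(le_trans (ler_norm _)).
    have : Num.min q (1 / 2) <= 1 / 2 by rewrite ge_min lexx orbT.
    nra.
  have tlt : tau n w <= (1 + q) * t n w.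
    move: tt; rewrite (gtr0_norm t0) => /(le_trans (ler_norm _)).
    have : Num.min q (1 / 2) <= q by rewrite ge_min lexx.
    nra.
  have ut : u / a n < t n w.
    rewrite ltr_pdivrMr//.
    have : (1 + q) * u < (1 + q) * (t n w * a n).
      apply: (lt_le_trans qu); apply: (le_trans u0w).
      by rewrite mulrA [leRHS]mulrC ler_pM2l.
    by rewrite ltr_pM2l// addr_gt0.
  have : k - h / 2 <= Num.sqrt n%:R * y n w.
    move: (x n w) (y n w) (t n w) xM yM tn ut; near: n.
    have := nearest_gt_near M0 k0 h20 u_gt0 kg; apply: filterS => n H x' y' t' ? ? ? ?.
    exact: (H x' y' t').
  lra.
apply: (le_trans (fine_probabilityU P (measurable_far M n) (measurableC mY))).
rewrite fine_probabilityC//.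
have : Pr (far M n) <= e / 4 by near: n.
lra.
Unshelve. all: by end_near. Qed.

Lemma tail_lower k e u u0 : 0 < u0 < u -> 0 <= k -> 0 < e ->
  (\forall n \near \oo, Num.sqrt n%:R * g (u / a n) <= k) ->
  \forall n \near \oo, 1 - Phi (k / sigma) - e <= Pr [set w | u0 < a n * tau n w].
Proof.
move=> /andP[u0_gt0 uu0] k0 e0 kg; have u_gt0 := lt_trans u0_gt0 uu0.
have e40 : 0 < e / 4 by rewrite divr_gt0.
have [M M0 farM] := far_small e40.
have [h h0 [_ hk]] := Phi_modulus k e40.
pose q := (u - u0) / (2 * u).
have q0 : 0 < q by rewrite divr_gt0 ?subr_gt0// mulr_gt0.
have qu : u0 < (1 - q) * u.
  by have -> : (1 - q) * u = (u + u0) / 2; [rewrite /q; field; rewrite gt_eqF|lra].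
have q1 : 0 < 1 - q.
  by rewrite -(pmulr_lgt0 _ u_gt0) (lt_trans u0_gt0).
have [s s_gt0 taus] := tau_t q0.
near=> n.
have n0 : (0 < n)%N by near: n; exists 1%N.
have an0 : 0 < a n by near: n; exact: cvgry_gt.
have Y : Pr [set w | Num.sqrt n%:R * y n w <= k + h] <= Phi ((k + h) / sigma) + e / 4.
  near: n; have := @clt_y (k + h); move=> /cvgr_le; apply.
  by rewrite ltrDl.
have mY := measurable_le (k + h) (mscaled (my n)).
have mA : measurable [set w | a n * tau n w <= u0] by exact: measurable_le.
have -> : [set w | u0 < a n * tau n w] = ~` [set w | a n * tau n w <= u0].
  by apply/seteqP; split => w /=; rewrite ltNge => /negP.
rewrite fine_probabilityC//.
suff : Pr [set w | a n * tau n w <= u0] <=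
    Pr (far M n `|` [set w | Num.sqrt n%:R * y n w <= k + h]).
  move=> /le_trans/(_ (fine_probabilityU P (measurable_far M n) mY)).
  have : Pr (far M n) <= e / 4 by near: n.
  lra.
apply: le_fine_probability => //; first exact: measurableU.
move=> w /= u0w; have [|/not_orP[/= /negP + /negP]] := pselect (far M n w); first by left.
rewrite -!leNgt => xM yM; right=> /=.
have tn := nearest_t w n0.
have ts : `|t n w| <= s.
  apply: ltW; move: (x n w) (y n w) (t n w) xM yM tn; near: n.
  exact: nearest_local.
have tt := taus n w n0 ts.
have ut : t n w < u / a n.
  have [t0|t0] := leP (t n w) 0; first by rewrite (le_lt_trans t0)// divr_gt0.
  rewrite ltr_pdivlMr//.
  have : (1 - q) * (t n w * a n) < (1 - q) * u.
    apply: le_lt_trans qu; apply: le_trans u0w.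
    rewrite mulrA mulrC ler_pM2l//.
    move: tt; rewrite (gtr0_norm t0) distrC => /(le_trans (ler_norm _)); lra.
  by rewrite ltr_pM2l.
move: (x n w) (y n w) (t n w) xM yM tn ut; near: n.
have := nearest_lt_near M0 k0 h0 u_gt0 kg; apply: filterS => n H x' y' t' ? ? ? ?.
exact: (H x' y' t').
Unshelve. all: by end_near. Qed.

(** The law of [tau] beyond [u0] only depends on the scaled slope
    [Num.sqrt n%:R * g (u / a n)] of the radius for [u] near [u0]. For [l = 0]
    the lower bound is trivial, so that slopes tending to infinity are
    covered. *)
Lemma tail_cvg u0 l : 0 < u0 ->
  (forall e, 0 < e -> exists u k, [/\ 0 < u < u0, 0 <= k,
    1 - Phi (k / sigma) <= l + e &
    \forall n \near \oo, k <= Num.sqrt n%:R * g (u / a n)]) ->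
  (0 < l -> forall e, 0 < e -> exists u k, [/\ u0 < u, 0 <= k,
    l - e <= 1 - Phi (k / sigma) &
    \forall n \near \oo, Num.sqrt n%:R * g (u / a n) <= k]) ->
  0 <= l ->
  Pr [set w | u0 <= a n * tau n w] @[n --> \oo] --> l /\
  Pr [set w | u0 < a n * tau n w] @[n --> \oo] --> l.
Proof.
move=> u00 up lo l0.
have sub n : Pr [set w | u0 < a n * tau n w] <= Pr [set w | u0 <= a n * tau n w].
  by apply: le_fine_probability => // w /= /ltW.
have bounds e : 0 < e -> \forall n \near \oo,
    l - e <= Pr [set w | u0 < a n * tau n w] /\
    Pr [set w | u0 <= a n * tau n w] <= l + e.
  move=> e0; have e20 : 0 < e / 2 by rewrite divr_gt0.
  have [u [k [uu0 k0 kl kg]]] := up _ e20.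
  have H1 := tail_upper uu0 k0 e20 kg.
  have H2 : \forall n \near \oo, l - e <= Pr [set w | u0 < a n * tau n w].
    move: l0; rewrite le_eqVlt => /predU1P[<-|l_gt0].
      by apply: nearW => n; rewrite (le_trans _ (fine_probability_ge0 _ _))// sub0r oppr_le0 ltW.
    have [u' [k' [uu0' k0' kl' kg']]] := lo l_gt0 _ e20.
    have u0u' : 0 < u0 < u' by rewrite u00.
    have := tail_lower u0u' k0' e20 kg'; apply: filterS => n; lra.
  by near=> n; split; [near: n|apply: (@le_trans _ _ (1 - Phi (k / sigma) + e / 2));
    [near: n|lra]].
split; apply/cvgrPdist_le => e e0; have := bounds e e0; apply: filterS => n [h1 h2];
  have := sub n; rewrite ler_norml => h3; apply/andP; split; lra.
Unshelve. all: by end_near. Qed.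

End tails.

End asymptotics.

End nearest_point.

(** * The curve of an increasing function *)

Section curve_of_increasing_function.
Context {R : realType} (b : R) (f h : R -> R).
Hypothesis b_gt0 : 0 < b.
Hypothesis f0 : f 0 = 0.
Hypothesis f_incr : forall y z, 0 <= y -> y < z -> z <= b -> f y < f z.
(* [curve_inv] is a mere choice of preimages; [h] is the explicit formula that
   is available for a concrete [f]. *)
Hypothesis h_inv : forall t, 0 <= t <= f b -> 0 <= h t <= b /\ f (h t) = t.
Hypothesis mh : measurable_fun setT h.
Implicit Types s t : R.

Let B := f b.
Let r := curve_radius b f.
Local Notation mu := (@lebesgue_measure R).

Lemma increasing_end_gt0 : 0 < B.
Proof. by rewrite -f0 /B; exact: f_incr. Qed.

Lemma inverse_homo s t : 0 <= s -> s <= t -> t <= B -> h s <= h t.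
Proof.
move=> s0 st tB; rewrite leNgt; apply/negP => hts.
have [/andP[hs0 hsb] fhs] : 0 <= h s <= b /\ f (h s) = s.
  by apply: h_inv; rewrite s0 (le_trans st).
have [/andP[ht0 htb] fht] : 0 <= h t <= b /\ f (h t) = t.
  by apply: h_inv; rewrite (le_trans s0).
by have := f_incr ht0 hts hsb; rewrite fhs fht ltNge st.
Qed.

Lemma inverse_ge0 t : 0 <= t <= B -> 0 <= h t.
Proof. by move=> /h_inv[/andP[]]. Qed.

Lemma inverse_le t : 0 <= t <= B -> h t <= b.
Proof. by move=> /h_inv[/andP[]]. Qed.

Lemma inverse_gt0 t : 0 < t <= B -> 0 < h t.
Proof.
case/andP=> t0 tB; have tB' : 0 <= t <= B by rewrite ltW.
have [/andP[+ _] fht] := h_inv tB'.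
by rewrite le_eqVlt => /predU1P[h0|//]; move: t0; rewrite -fht -h0 f0 ltxx.
Qed.

Let f_injective : {in `[0, b]%classic &, injective f}.
Proof.
move=> y z; rewrite !inE/= !in_itv/= => /andP[y0 yb] /andP[z0 zb] fyz.
case: (ltgtP y z) => // yz.
- by have := f_incr y0 yz zb; rewrite fyz ltxx.
- by have := f_incr z0 yz yb; rewrite fyz ltxx.
Qed.

Lemma curve_inv_formula t : 0 <= t <= B -> curve_inv b f t = h t.
Proof.
move=> tB; have [htb fht] := h_inv tB.
rewrite /curve_inv -{1}fht; apply: pinvKV => //.
by rewrite inE/= in_itv.
Qed.

Lemma curve_radius_formula t : t <= B ->
  r t = 1 + \int[mu]_(x in `[0, t]) h x.
Proof.
move=> tB; congr (1 + _); apply: eq_Rintegral => x; rewrite inE/= in_itv/=.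
by case/andP=> x0 xt; rewrite curve_inv_formula// x0 (le_trans xt).
Qed.

Lemma curve_radius0 : r 0 = 1.
Proof.
rewrite curve_radius_formula ?(ltW increasing_end_gt0)//.
by rewrite set_itv1 Rintegral_set1 addr0.
Qed.

Let h_integrable t : t <= B -> mu.-integrable `[0, t] (EFin \o h).
Proof.
move=> tB; apply: measurable_bounded_integrable => //.
- by apply: compact_finite_measure; exact: segment_compact.
- exact: measurable_funTS.
- exists b; split; first exact: num_real.
  move=> M bM x /=; rewrite in_itv/= => /andP[x0 xt].
  have xB : 0 <= x <= B by rewrite x0 (le_trans xt).
  by rewrite ger0_norm ?inverse_ge0// (le_trans (inverse_le xB))// ltW.
Qed.

(** The radius is an integral of the increasing function [h]. *)
Lemma curve_radius_increment s t : 0 <= s -> s <= t -> t <= B ->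
  h s * (t - s) <= r t - r s <= h t * (t - s).
Proof.
move=> s0 st tB; have sB := le_trans st tB.
have it := h_integrable tB.
have -> : r t - r s = \int[mu]_(x in `]s, t]) h x.
  rewrite !curve_radius_formula// opprD addrACA subrr add0r.
  by apply: Rintegral_itvB => //; rewrite bnd_simp.
have is_ : mu.-integrable `]s, t] (EFin \o h).
  apply: integrableS it => //; apply: subset_itvr; rewrite bnd_simp.
  by [].
have ic c : mu.-integrable `]s, t] (EFin \o cst c).
  apply: (@integrableS _ _ _ mu `[s, t]) => //; first exact: subset_itv_oc_cc.
  by apply: continuous_compact_integrable => //; [exact: segment_compact|exact: continuous_subspaceT (fun x => cvg_cst _)].
have cE c : \int[mu]_(x in `]s, t]) c = c * (t - s).
  transitivity (c * fine (lebesgue_measure `]s, t]%classic)).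
    exact: Rintegral_cst.
  rewrite lebesgue_measure_itv/= lte_fin; case: ltP => // ts.
  by have -> : s = t; [apply/eqP; rewrite eq_le st|rewrite subrr].
rewrite -!cE; apply/andP; split.
- apply: le_Rintegral => //; [exact: ic|move=> x /=].
  rewrite in_itv/= => /andP[sx xt].
  by apply: inverse_homo => //; [exact: ltW|exact: le_trans tB].
- apply: le_Rintegral => //; [exact: ic|move=> x /=].
  rewrite in_itv/= => /andP[sx xt].
  by apply: inverse_homo => //; rewrite ltW// (le_lt_trans s0).
Qed.

(** Squared distances differ from the cost by a constant, as
    [cos t ^+ 2 + sin t ^+ 2 = 1]. *)
Lemma curve_projection_nearest z t : t \in `[- B, B] ->
  argmin_dist (curve b f) z (curve_point b f t) -> nearest B r z.1 z.2 t.
Proof.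
rewrite in_itv/= -ler_norml => tB [_ tmin]; split=> // s sB.
have := tmin (curve_point b f s).
have qs : curve b f (curve_point b f s).
  by exists s => //=; rewrite in_itv/= -ler_norml.
move=> /(_ qs); rewrite /enorm ler_sqrt ?addr_ge0 ?sqr_ge0//.
rewrite /curve_point /distance_cost -/r/=.
have expand (q c n : R) : c ^+ 2 + n ^+ 2 = 1 ->
    (z.1 - q * c) ^+ 2 + (z.2 - q * n) ^+ 2 =
    z.1 ^+ 2 + z.2 ^+ 2 + (q ^+ 2 - 2 * q * (z.1 * c + z.2 * n)).
  move=> cn; have -> : q ^+ 2 = q ^+ 2 * (c ^+ 2 + n ^+ 2) by rewrite cn mulr1.
  ring.
by rewrite !expand ?cos2Dsin2// lerD2l.
Qed.

(** Near its tip the curve is vertical and parametrized at unit speed. *)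
Lemma curve_point_ordinate e : 0 < e -> exists2 s, 0 < s &
  forall t, `|t| <= s -> `|(curve_point b f t).2 - t| <= e * `|t|.
Proof.
move=> e0; have B0 := increasing_end_gt0.
exists (Num.min (Num.min B 1) (e / (b + 1))).
  by rewrite !lt_min B0 ltr01 divr_gt0// addr_gt0.
suff pos t : 0 <= t -> t <= B -> t <= 1 -> t <= e / (b + 1) ->
    `|r t * sin t - t| <= e * t.
  move=> t; rewrite !le_min => /andP[/andP[tB t1] te]; rewrite /curve_point/= -/r.
  have [t0|/ltW t0] := leP 0 t.
    by move: tB t1 te; rewrite (ger0_norm t0); exact: pos.
  move: tB t1 te; rewrite (ler0_norm t0) => tB t1 te.
  have := pos (- t); rewrite oppr_ge0 => /(_ t0 tB t1 te).
  by rewrite sinN mulrN -opprD normrN.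
move=> t0 tB t1; rewrite ler_pdivlMr ?addr_gt0// => te.
have tB' : 0 <= t <= B by rewrite t0.
have /andP[_ r1] := curve_radius_increment (lexx 0) t0 tB.
have r1' : 1 <= r t.
  rewrite -curve_radius0 -subr_ge0.
  have /andP[+ _] := curve_radius_increment (lexx 0) t0 tB.
  by apply: le_trans; rewrite subr0 mulr_ge0// inverse_ge0// lexx ltW.
have hb := inverse_le tB'.
rewrite curve_radius0 subr0 in r1.
have /andP[] := sinB_bound (lexx 0) t0 t1; rewrite sin0 !subr0 => l1 l2.
have s0 : 0 <= sin t by apply: le_trans l1; rewrite mulr_ge0// subr_ge0 expr_le1.
have h1 : r t - 1 <= b * t.
  by apply: (le_trans r1); rewrite ler_wpM2r.
have h2 : 0 <= (r t - 1) * sin t <= b * t * t.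
  by rewrite mulr_ge0 ?subr_ge0//= ler_pM// subr_ge0.
have h3 : t ^+ 2 * t <= t * t.
  by rewrite expr2 -mulrA ler_wpM2l// ler_piMl.
have h4 : (b * t + t) * t <= e * t by rewrite ler_wpM2r//; lra.
by rewrite ler_norml; apply/andP; split; lra.
Qed.

End curve_of_increasing_function.

(** * Powers, divergence and limits of distribution functions *)

Section divergence_and_powers.
Context {R : realType}.
Implicit Types (u : nat -> R) (p x y : R).

Lemma cvgy_powR u p : 0 < p -> u n @[n --> \oo] --> +oo ->
  u n `^ p @[n --> \oo] --> +oo.
Proof.
move=> p0 uy; apply/cvgryPge => M; near=> n.
have M0 : 0 <= Num.max M 0 by rewrite le_max lexx orbT.
apply: (@le_trans _ _ (Num.max M 0)); first by rewrite le_max lexx.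
have -> : Num.max M 0 = (Num.max M 0 `^ p^-1) `^ p.
  by rewrite -powRrM mulVf ?gt_eqF// powRr1.
have un : Num.max M 0 `^ p^-1 <= u n by near: n; exact: cvgry_ge.
apply: ge0_ler_powR => //; first exact: ltW.
- by rewrite nnegrE powR_ge0.
- by rewrite nnegrE (le_trans _ un)// powR_ge0.
Unshelve. all: by end_near. Qed.

Lemma cvgy_sqrtn : Num.sqrt n%:R @[n --> \oo] --> (+oo : set_system R).
Proof.
rewrite (_ : (fun n => _) = fun n : nat => (n%:R : R) `^ 2^-1).
  by apply: cvgy_powR; [rewrite invr_gt0|exact: cvgr_idn].
by apply/funext => n; rewrite powR12_sqrt.
Qed.

Lemma cvgy_lnn : ln n%:R @[n --> \oo] --> (+oo : set_system R).
Proof.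
apply/cvgryPge => M; near=> n.
have nM : expR M <= n%:R by near: n; have := @cvgr_idn R; move=> /cvgryPge; exact.
by rewrite -[M]expRK ler_ln// posrE ?expR_gt0// (lt_le_trans (expR_gt0 M)).
Unshelve. all: by end_near. Qed.

Lemma cvgy_expR u : u n @[n --> \oo] --> +oo ->
  expR (u n) @[n --> \oo] --> +oo.
Proof.
move=> uy; apply/cvgryPge => M; near=> n.
apply: le_trans (expR_ge1Dx _); rewrite -lerBlDl.
by near: n; exact: cvgry_ge.
Unshelve. all: by end_near. Qed.

Lemma cvgy_Mpos u x : 0 < x -> u n @[n --> \oo] --> +oo ->
  x * u n @[n --> \oo] --> +oo.
Proof.
move=> x0 uy; apply/cvgryPge => M; near=> n.
by rewrite -ler_pdivrMl//; near: n; exact: cvgry_ge.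
Unshelve. all: by end_near. Qed.

Lemma powR_continuous x p : 0 < x -> {for x, continuous (fun y : R => y `^ p)}.
Proof.
move=> x0; apply/differentiable_continuous/derivable1_diffP.
by apply: derivable_powR; rewrite in_itv/= x0.
Qed.

Lemma continuous_dist_le (g : R -> R) x e : {for x, continuous g} -> 0 < e ->
  \forall y \near x, `|g x - g y| <= e.
Proof. by move=> /cvgrPdist_le; apply. Qed.

Lemma powR_gt0_decr p x y : 0 < p -> 0 < x -> x < y -> y `^ (- p) < x `^ (- p).
Proof.
move=> p0 x0 xy; rewrite !powRN ltf_pV2 ?posrE ?powR_gt0//; last exact: lt_trans xy.
by apply: gt0_ltr_powR => //; rewrite nnegrE ltW// (lt_trans x0).
Qed.

Lemma powR_powK p x : p != 0 -> 0 <= x -> (x `^ p^-1) `^ p = x.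
Proof. by move=> p0 x0; rewrite -powRrM mulVf// powRr1. Qed.

Lemma powR_powNK p x : p != 0 -> 0 <= x -> (x `^ (- 1 / p)) `^ (- p) = x.
Proof.
move=> p0 x0; rewrite -powRrM (_ : - 1 / p * - p = 1) ?powRr1//.
by field.
Qed.

Lemma powRN_powK p x : p != 0 -> 0 <= x -> (x `^ (- p)) `^ (- 1 / p) = x.
Proof.
move=> p0 x0; rewrite -powRrM (_ : - p * (- 1 / p) = 1) ?powRr1//.
by field.
Qed.

End divergence_and_powers.

Section distribution_functions.
Context {R : realType} {d : measure_display} {T : measurableType d}.
Context (P : probability T R).
Implicit Types l s : R.

Local Notation Pr A := (fine (P A)).

Lemma cvg_probability (A : nat -> set T) l : (forall n, measurable (A n)) ->
  Pr (A n) @[n --> \oo] --> l -> P (A n) @[n --> \oo] --> l%:E.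
Proof.
move=> mA Al; rewrite (_ : (fun n => _) = fun n => (Pr (A n))%:E).
  by apply: cvg_EFin => //; exact: nearW.
by apply/funext => n; rewrite fine_probabilityK.
Qed.

Context (V : nat -> T -> R).
Hypothesis mV : forall n, measurable_fun setT (V n).

Lemma cvg_le_of_gt s l : Pr [set w | s < V n w] @[n --> \oo] --> l ->
  Pr [set w | V n w <= s] @[n --> \oo] --> 1 - l.
Proof.
move=> Vl; rewrite (_ : (fun n => _) = fun n => 1 - Pr [set w | s < V n w]).
  by apply: cvgB => //; exact: cvg_cst.
apply/funext => n; have mA := measurable_le s (mV n).
have -> : [set w | s < V n w] = ~` [set w | V n w <= s].
  by apply/seteqP; split => w /=; rewrite ltNge => /negP.
by rewrite fine_probabilityC// subKr.
Qed.

(** By monotonicity, a symmetric limit gives mass 1/2 to the half-line up to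
    its centre. *)
Lemma cvg_le0_half :
  (forall e, 0 < e -> exists u l, [/\ 0 < u, 1 / 2 - e <= l,
    Pr [set w | u < V n w] @[n --> \oo] --> l &
    Pr [set w | V n w <= - u] @[n --> \oo] --> l]) ->
  Pr [set w | V n w <= 0] @[n --> \oo] --> (1 / 2 : R).
Proof.
move=> half; apply/cvgrPdist_le => e e0.
have e20 : 0 < e / 2 by rewrite divr_gt0.
have [u [l [u0 hl /cvg_le_of_gt up lo]]] := half _ e20.
near=> n.
have h1 : Pr [set w | V n w <= u] <= 1 - l + e / 2.
  by near: n; apply: (cvgr_le _ up); rewrite ltrDl.
have h2 : l - e / 2 <= Pr [set w | V n w <= - u].
  by near: n; apply: (cvgr_ge _ lo); rewrite ltrBlDr ltrDl.
have h3 : Pr [set w | V n w <= 0] <= Pr [set w | V n w <= u].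
  apply: le_fine_probability; [exact: measurable_le|exact: measurable_le|].
  by move=> w /= /le_trans; apply; exact: ltW.
have h4 : Pr [set w | V n w <= - u] <= Pr [set w | V n w <= 0].
  apply: le_fine_probability; [exact: measurable_le|exact: measurable_le|].
  by move=> w /= /le_trans; apply; rewrite oppr_le0 ltW.
by rewrite ler_norml; apply/andP; split; lra.
Unshelve. all: by end_near. Qed.

End distribution_functions.

(** * Power functions *)

Section signed_power.
Context {R : realType}.
Implicit Types (p x y s : R).

(** The odd power function. Applied to a centred Gaussian variable, it has the
    limit law of the case of a power [f]. *)
Definition spow p x : R := Num.sg x * `|x| `^ p.

Lemma ger0_spow p x : p != 0 -> 0 <= x -> spow p x = x `^ p.
Proof.
move=> p0; rewrite le_eqVlt => /predU1P[<-|x0].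
  by rewrite /spow sgr0 mul0r powR0.
by rewrite /spow gtr0_sg// mul1r gtr0_norm.
Qed.

Lemma spowN p x : spow p (- x) = - spow p x.
Proof. by rewrite /spow sgrN normrN mulNr. Qed.

Lemma spow_homo p : 0 < p -> {homo spow p : x y / x < y}.
Proof.
move=> p0; have pn0 : p != 0 by rewrite gt_eqF.
have pos x y : 0 <= x -> x < y -> spow p x < spow p y.
  move=> x0 xy; have y0 : 0 <= y by rewrite (le_trans x0)// ltW.
  by rewrite !ger0_spow//; apply: gt0_ltr_powR.
move=> x y xy; have [x0|x0] := leP 0 x; first exact: pos.
have [y0|y0] := leP y 0.
  by rewrite -ltrN2 -!spowN; apply: pos; rewrite ?oppr_ge0// ltrN2.
apply: (@lt_trans _ _ (spow p 0)); last exact: pos.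
rewrite -ltrN2 -!spowN oppr0; apply: pos => //.
by rewrite oppr_gt0.
Qed.

Lemma spowK p : p != 0 -> cancel (spow p^-1) (spow p).
Proof.
move=> p0; have pos x : 0 <= x -> spow p (spow p^-1 x) = x.
  move=> x0; rewrite [spow p^-1 x]ger0_spow ?invr_eq0// ger0_spow ?powR_ge0//.
  exact: powR_powK.
move=> x; have [x0|/ltW x0] := leP 0 x; first exact: pos.
by apply: oppr_inj; rewrite -!spowN pos// oppr_ge0.
Qed.

Lemma spow_le p x s : 0 < p -> (spow p x <= s) = (x <= spow p^-1 s).
Proof.
move=> p0; rewrite -{1}(spowK (lt0r_neq0 p0) s).
by rewrite (le_mono (spow_homo p0)).
Qed.

End signed_power.

Section power_function.
Context {R : realType} (b gamma : R).
Hypothesis b_gt0 : 0 < b.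
Hypothesis gamma_gt0 : 0 < gamma.

Let f : R -> R := zero_at0 (fun y => y `^ gamma).
Let h (t : R) : R := t `^ gamma^-1.

Let gamma_neq0 : gamma != 0. Proof. by rewrite gt_eqF. Qed.

Let fE y : 0 <= y -> f y = y `^ gamma.
Proof.
rewrite le_eqVlt /f /zero_at0 => /predU1P[<-|->//].
by rewrite ltxx powR0.
Qed.

Lemma power_f0 : f 0 = 0.
Proof. by rewrite /f /zero_at0 ltxx. Qed.

Lemma power_incr y z : 0 <= y -> y < z -> z <= b -> f y < f z.
Proof.
move=> y0 yz _; have z0 := le_trans y0 (ltW yz); rewrite !fE//.
exact: gt0_ltr_powR.
Qed.

Lemma power_inv t : 0 <= t <= f b -> 0 <= h t <= b /\ f (h t) = t.
Proof.
case/andP=> t0; rewrite (fE (ltW b_gt0)) => tb.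
split; last by rewrite fE ?powR_ge0// powR_powK.
rewrite powR_ge0/= -[leRHS](powRr1 (ltW b_gt0)) -(mulfV gamma_neq0) powRrM.
by apply: ge0_ler_powR; rewrite ?nnegrE ?invr_ge0 ?powR_ge0// ltW.
Qed.

Lemma power_inv_measurable : measurable_fun setT h.
Proof. exact: measurable_powR. Qed.

Let powR_at_right0 p : 0 < p -> x `^ p @[x --> 0^'+] --> (0 : R) `^ p.
Proof. by move=> p0; rewrite powR0 ?gt_eqF//; exact: powR_cvg0. Qed.

Lemma power_radius t : t \in `[0, f b] -> curve_radius b f t =
  1 + gamma / (1 + gamma) * t `^ ((1 + gamma) / gamma).
Proof.
rewrite in_itv/= => /andP[t0 tB].
rewrite (curve_radius_formula power_incr power_inv tB); congr (1 + _).
set p := (1 + gamma) / gamma; set c := gamma / (1 + gamma).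
have p0 : 0 < p by rewrite divr_gt0// addr_gt0.
have cp : c * p = 1 by rewrite /c /p; field; rewrite gamma_neq0 gt_eqF// addr_gt0.
have pE : p - 1 = gamma^-1 by rewrite /p; field.
move: t0; rewrite le_eqVlt => /predU1P[<-|t0].
  by rewrite set_itv1 Rintegral_set1 powR0 ?gt_eqF// mulr0.
pose F (x : R) : R := c * x `^ p.
have dF (x : R) : 0 < x -> is_derive x 1 F (h x).
  move=> x0; have D := is_derive1_powR p x0.
  apply: is_derive_eq; rewrite /GRing.scale/= pE.
  by rewrite mulrA cp mul1r.
have cF (x : R) : 0 < x -> {for x, continuous F}.
  move=> x0; apply/differentiable_continuous/derivable1_diffP.
  by have [] := dF x x0.
have ch : {within `[0, t], continuous h}.
  apply/(continuous_within_itvP _ t0); split.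
  - by move=> x; rewrite in_itv/= => /andP[x0 _]; exact: powR_continuous.
  - by apply: powR_at_right0; rewrite invr_gt0.
  - by apply: cvg_at_left_filter; exact: powR_continuous.
have LR : derivable_oo_LRcontinuous F 0 t.
  split.
  - by move=> x; rewrite in_itv/= => /andP[x0 _]; have [] := dF x x0.
  - by apply: cvgMl_tmp; exact: powR_at_right0.
  - by apply: cvg_at_left_filter; exact: cF.
have F'h : {in `]0, t[, F^`()%classic =1 h}.
  by move=> x; rewrite in_itv/= => /andP[x0 _]; rewrite derive1E; have [_ ->] := dF x x0.
rewrite /Rintegral (continuous_FTC2 t0 ch LR F'h)/=.
by rewrite /F powR0 ?gt_eqF// mulr0 subr0.
Qed.

(** The scaling by [n%:R `^ (gamma / 2)] is the one that cancels [Num.sqrt n%:R]. *)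
Lemma power_slope u n : 0 < u -> (0 < n)%N ->
  Num.sqrt n%:R * h (u / n%:R `^ (gamma / 2)) = u `^ gamma^-1.
Proof.
move=> u0 n0; rewrite /h powRM ?invr_ge0 ?powR_ge0 ?(ltW u0)//.
rewrite -powRN -powRrM -powR12_sqrt ?ler0n//.
rewrite mulrCA -powRD; last by rewrite pnatr_eq0 -lt0n n0 implybT.
rewrite (_ : 2^-1 + _ = 0); first by rewrite powRr0 mulr1.
by field.
Qed.

End power_function.

(** * Powers of the logarithm *)

Section logarithmic_function.
Context {R : realType} (b gamma : R).
Hypothesis b_gt0 : 0 < b.
Hypothesis b_lt1 : b < 1.
Hypothesis gamma_gt0 : 0 < gamma.

Let f : R -> R := zero_at0 (fun y => (- ln y) `^ (- gamma)).

(** The value at 0 has to be singled out: [0 `^ (- 1 / gamma)] is 0, so that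
    the exponential alone would be 1 there. *)
Definition logarithmic_inverse (t : R) : R :=
  if t == 0 then 0 else expR (- t `^ (- 1 / gamma)).

Local Notation h := logarithmic_inverse.

Let gamma_neq0 : gamma != 0. Proof. by rewrite gt_eqF. Qed.

Let lnN_gt0 y : 0 < y -> y <= b -> 0 < - ln y.
Proof. by move=> y0 yb; rewrite oppr_gt0 ln_lt0// y0 (le_lt_trans yb). Qed.

Let fE y : 0 < y -> f y = (- ln y) `^ (- gamma).
Proof. by rewrite /f /zero_at0 => ->. Qed.

Let hE t : 0 < t -> h t = expR (- t `^ (- 1 / gamma)).
Proof. by move=> t0; rewrite /h gt_eqF. Qed.

Lemma logarithmic_f0 : f 0 = 0.
Proof. by rewrite /f /zero_at0 ltxx. Qed.

Lemma logarithmic_incr y z : 0 <= y -> y < z -> z <= b -> f y < f z.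
Proof.
rewrite le_eqVlt => /predU1P[<-|y0] yz zb.
  by rewrite logarithmic_f0 fE// powR_gt0// lnN_gt0.
have z0 := lt_trans y0 yz; rewrite !fE//.
by apply: powR_gt0_decr; rewrite ?lnN_gt0// ltrN2 ltr_ln.
Qed.

Lemma logarithmic_inv t : 0 <= t <= f b -> 0 <= h t <= b /\ f (h t) = t.
Proof.
case/andP; rewrite le_eqVlt => /predU1P[<-|t0] tb.
  by rewrite /h eqxx lexx logarithmic_f0 ltW.
rewrite hE// fE ?expR_gt0// expRK opprK powR_powNK ?(ltW t0)//; split=> //.
rewrite expR_ge0/= -[leRHS](lnK (b_gt0 : b \is Num.pos)) ler_expR lerNl.
have lb0 := lnN_gt0 b_gt0 (lexx b).
rewrite -(powRN_powK gamma_neq0 (ltW lb0)).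
move: tb; rewrite fE// le_eqVlt => /predU1P[->//|tb].
rewrite (_ : - 1 / gamma = - gamma^-1); last by rewrite mulN1r.
by apply/ltW/powR_gt0_decr => //; rewrite invr_gt0.
Qed.

Lemma logarithmic_inv_measurable : measurable_fun setT h.
Proof.
apply: measurable_fun_ifT => //; first exact: measurable_fun_eqr.
by apply: measurableT_comp => //; exact: measurableT_comp.
Qed.

Lemma logarithmic_radius t : t \in `[0, f b] -> curve_radius b f t =
  1 + \int[lebesgue_measure]_(x in `[0, t]) expR (- x `^ (- 1 / gamma)).
Proof.
rewrite in_itv/= => /andP[t0 tB].
rewrite (curve_radius_formula logarithmic_incr logarithmic_inv tB).
have mh := logarithmic_inv_measurable.
have me : measurable_fun setT (fun x : R => expR (- x `^ (- 1 / gamma))).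
  by apply: measurableT_comp => //; exact: measurableT_comp.
congr (1 + _).
rewrite /Rintegral; congr fine.
rewrite -integral_itv_obnd_cbnd; last exact/measurable_EFinP/measurable_funTS.
rewrite -[RHS]integral_itv_obnd_cbnd; last exact/measurable_EFinP/measurable_funTS.
apply: eq_integral => x; rewrite inE/= in_itv/= => /andP[x0 _].
by congr EFin; exact: hE.
Qed.

Lemma logarithmic_slope u n : 0 < u -> (1 < n)%N ->
  Num.sqrt n%:R * h (u / (1 / 2 * ln n%:R) `^ gamma) =
  expR (1 / 2 * ln n%:R * (1 - u `^ (- 1 / gamma))).
Proof.
move=> u0 n1; have n0 : (0 : R) < n%:R by rewrite ltr0n ltnW.
pose L : R := 1 / 2 * ln n%:R.
have L0 : 0 < L by rewrite mulr_gt0// ln_gt0// ltr1n.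
have sqrtE : Num.sqrt n%:R = expR L :> R.
  by rewrite -powR12_sqrt ?ler0n// /powR gt_eqF// /L div1r.
rewrite -/L sqrtE hE ?divr_gt0 ?powR_gt0// -expRD; congr expR.
rewrite powRM ?(ltW u0) ?invr_ge0 ?powR_ge0//.
rewrite -powRN powRN_powK ?(ltW L0)//.
by rewrite mulrBr mulr1 [u `^ _ * L]mulrC.
Qed.

End logarithmic_function.

(** * Exponentials of powers *)

Section exponential_function.
Context {R : realType} (b gamma : R).
Hypothesis b_gt0 : 0 < b.
Hypothesis gamma_gt0 : 0 < gamma.

Let f : R -> R := zero_at0 (fun y => expR (- y `^ (- gamma))).
Let h (t : R) : R := (ln t^-1) `^ (- 1 / gamma).

Let gamma_neq0 : gamma != 0. Proof. by rewrite gt_eqF. Qed.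

Let fE y : 0 < y -> f y = expR (- y `^ (- gamma)).
Proof. by rewrite /f /zero_at0 => ->. Qed.

Let h0 : h 0 = 0.
Proof.
by rewrite /h invr0 ln0// powR0// mulf_neq0 ?invr_eq0// oppr_eq0 oner_eq0.
Qed.

Lemma exponential_f0 : f 0 = 0.
Proof. by rewrite /f /zero_at0 ltxx. Qed.

Lemma exponential_incr y z : 0 <= y -> y < z -> z <= b -> f y < f z.
Proof.
rewrite le_eqVlt => /predU1P[<-|y0] yz _.
  by rewrite exponential_f0 fE// expR_gt0.
have z0 := lt_trans y0 yz; rewrite !fE// ltr_expR ltrN2.
exact: powR_gt0_decr.
Qed.

Lemma exponential_inv t : 0 <= t <= f b -> 0 <= h t <= b /\ f (h t) = t.
Proof.
case/andP; rewrite le_eqVlt => /predU1P[<-|t0] tb.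
  by rewrite h0 lexx exponential_f0 ltW.
have tp : t \is Num.pos by [].
have bp : 0 < b `^ (- gamma) by rewrite powR_gt0.
have lt_b : b `^ (- gamma) <= ln t^-1.
  rewrite lnV// lerNr -[leRHS](expRK (- b `^ (- gamma))).
  by rewrite ler_ln ?posrE ?expR_gt0//; move: tb; rewrite fE.
have lt0 : 0 < ln t^-1 := lt_le_trans bp lt_b.
have ht0 : 0 < h t by rewrite powR_gt0.
split; last by rewrite fE// powR_powNK ?(ltW lt0)// lnV// opprK lnK.
rewrite ltW//= -[leRHS](powRN_powK gamma_neq0 (ltW b_gt0)) /h.
move: lt_b; rewrite le_eqVlt => /predU1P[->//|lt_b].
rewrite (_ : - 1 / gamma = - gamma^-1); last by rewrite mulN1r.
by apply/ltW/powR_gt0_decr => //; rewrite invr_gt0.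
Qed.

Lemma exponential_inv_measurable : measurable_fun setT h.
Proof.
rewrite (_ : h = fun t => (- ln t) `^ (- 1 / gamma)).
  apply: (measurableT_comp (measurable_powR _)).
  by apply: measurableT_comp => //; exact: measurable_ln.
apply/funext => t; rewrite /h; have [t0|t0] := ltP 0 t; first by rewrite lnV.
by rewrite !ln0 ?oppr0// invr_le0.
Qed.

Lemma exponential_radius t : t \in `[0, f b] -> curve_radius b f t =
  1 + \int[lebesgue_measure]_(x in `[0, t]) (ln x^-1) `^ (- 1 / gamma).
Proof.
rewrite in_itv/= => /andP[_ tB].
by rewrite (curve_radius_formula exponential_incr exponential_inv tB).
Qed.

(** The scaled slope is [c * (1 - ln u / S `^ gamma) `^ (- 1 / gamma)] with
    [S := Num.sqrt n%:R / c]: the logarithm turns the scale [expR (S `^ gamma)]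
    into a leading term next to which [ln u] is negligible. *)
Lemma exponential_slope (c u : R) : 0 < c -> 0 < u ->
  Num.sqrt n%:R * h (u / expR ((Num.sqrt n%:R / c) `^ gamma)) @[n --> \oo]
    --> c.
Proof.
move=> c0 u0; pose S n : R := Num.sqrt n%:R / c.
have S_cvgy : S n @[n --> \oo] --> +oo.
  rewrite (_ : S = fun n => c^-1 * Num.sqrt n%:R).
    by apply: cvgy_Mpos; [rewrite invr_gt0|exact: cvgy_sqrtn].
  by apply/funext => n; rewrite /S mulrC.
have Sg_cvgy : S n `^ gamma @[n --> \oo] --> +oo by exact: cvgy_powR.
pose v n : R := 1 - ln u * (S n `^ gamma)^-1.
have v_cvg1 : v n @[n --> \oo] --> (1 : R).
  rewrite -[X in _ --> X]subr0 -{1}(mulr0 (ln u)).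
  apply: cvgB; first exact: cvg_cst.
  apply: cvgMl_tmp; apply/gtr0_cvgV0 => //.
  by have /cvgryPgt := Sg_cvgy; exact.
have limit : c * v n `^ (- 1 / gamma) @[n --> \oo] --> c.
  rewrite -[X in _ --> X]mulr1; apply: cvgMl_tmp.
  have : v n `^ (- 1 / gamma) @[n --> \oo] --> (1 : R) `^ (- 1 / gamma).
    have := @powR_continuous R 1 (- 1 / gamma) ltr01.
    exact: (@cvg_comp _ _ _ v (fun y : R => y `^ (- 1 / gamma)) _ _ _ v_cvg1).
  by rewrite powR1.
apply: cvg_trans limit; apply: near_eq_cvg; near=> n.
have Sn0 : 0 < S n by near: n; have /cvgryPgt := S_cvgy; exact.
have vn0 : 0 <= v n by near: n; exact: (cvgr_ge _ v_cvg1).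
rewrite -/(S n) /h; set a := S n `^ gamma.
have a0 : 0 < a by rewrite powR_gt0.
have -> : ln (u / expR a)^-1 = a * v n.
  rewrite lnV ?posrE ?divr_gt0 ?expR_gt0// lnM ?posrE ?invr_gt0 ?expR_gt0//.
  rewrite lnV ?posrE ?expR_gt0// expRK /v -/a mulrBr mulr1.
  by rewrite mulrCA mulfV ?gt_eqF// mulr1 opprB.
rewrite powRM ?(ltW a0)// /a -powRrM (_ : gamma * _ = - 1); last by field.
rewrite powR_inv1 ?(ltW Sn0)// mulrA; congr (_ * _).
have sq0 : 0 < Num.sqrt n%:R :> R by have := mulr_gt0 Sn0 c0; rewrite mulfVK ?gt_eqF.
by rewrite /S invf_div mulrCA mulfV ?gt_eqF// mulr1.
Unshelve. all: by end_near. Qed.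

End exponential_function.

(** * Moments of the observations *)

Section moments.
Context {R : realType} {d : measure_display} {T : measurableType d}.
Context (P : probability T R) (Z : {RV P >-> (R * R)%type}).

Lemma enorm_sqr (z : R * R) : enorm z ^+ 2 = z.1 ^+ 2 + z.2 ^+ 2.
Proof. by rewrite sqr_sqrtr// addr_ge0// sqr_ge0. Qed.

(** [`|X| <= 1 + X ^+ 2]. *)
Lemma square_integrable (X : T -> R) : measurable_fun setT X ->
  P.-integrable setT (EFin \o (fun w => X w ^+ 2)) ->
  P.-integrable setT (EFin \o X).
Proof.
move=> mX iX2.
have i1 := integrableD measurableT (finite_measure_integrable_cst P 1 measurableT) iX2.
apply: (le_integrable measurableT _ _ i1); first exact/measurable_EFinP.
move=> w _ /=; rewrite lee_fin [leRHS]ger0_norm ?addr_ge0 ?sqr_ge0//.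
have := sqr_ge0 (`|X w| - 1); rewrite -[X w ^+ 2]real_normK ?num_real//.
have := normr_ge0 (X w); nra.
Qed.

Lemma expectation_Rintegral (X : T -> R) (c : R) :
  ('E_P[X] = c%:E)%E -> \int[P]_w X w = c.
Proof. by rewrite unlock /Rintegral => ->. Qed.

Hypothesis Zmoment2 : ('E_P[(fun w => enorm (Z w) ^+ 2)%R] < +oo)%E.

Let mZ1 : measurable_fun setT (fun w => (Z w).1).
Proof. exact: measurableT_comp measurable_fst _. Qed.

Let mZ2 : measurable_fun setT (fun w => (Z w).2).
Proof. exact: measurableT_comp measurable_snd _. Qed.

Let integrable_enorm : P.-integrable setT
  (EFin \o (fun w => (Z w).1 ^+ 2 + (Z w).2 ^+ 2)).
Proof.
apply/integrableP; split.
  by apply/measurable_EFinP; apply: measurable_funD; exact: measurable_funX.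
move: Zmoment2; rewrite unlock; apply: le_lt_trans.
rewrite le_eqVlt; apply/orP; left; apply/eqP; apply: eq_integral => w _ /=.
by rewrite enorm_sqr ger0_norm// addr_ge0// sqr_ge0.
Qed.

Lemma integrable_fst_sqr :
  P.-integrable setT (EFin \o (fun w => (Z w).1 ^+ 2)).
Proof.
apply: (le_integrable measurableT _ _ integrable_enorm).
  by apply/measurable_EFinP; exact: measurable_funX.
move=> w _ /=; rewrite lee_fin !ger0_norm ?addr_ge0 ?sqr_ge0//.
by rewrite lerDl sqr_ge0.
Qed.

Lemma integrable_snd_sqr :
  P.-integrable setT (EFin \o (fun w => (Z w).2 ^+ 2)).
Proof.
apply: (le_integrable measurableT _ _ integrable_enorm).
  by apply/measurable_EFinP; exact: measurable_funX.
move=> w _ /=; rewrite lee_fin !ger0_norm ?addr_ge0 ?sqr_ge0//.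
by rewrite lerDr sqr_ge0.
Qed.

Lemma centred_variance sigma :
  ('E_P[(fun w => (Z w).2)] = 0)%E ->
  ('V_P[(fun w => (Z w).2)] = (sigma ^+ 2)%:E)%E ->
  \int[P]_w ((Z w).2 ^+ 2) = sigma ^+ 2.
Proof.
move=> EY; rewrite /variance covariance.unlock EY/= => VY.
apply: expectation_Rintegral; rewrite -VY; congr expectation.
by apply/funext => w; rewrite mulrfctE/= subr0 expr2.
Qed.

End moments.

(** * Tails of the projected means *)

Section projected_means.
Context {R : realType} {d : measure_display} {T : measurableType d}.
Context (P : probability T R) (Z : {RV P >-> (R * R)%type}).
Context (Zs : nat -> {RV P >-> (R * R)%type}) (sigma : R).
Hypothesis Zmoment2 : ('E_P[(fun w => enorm (Z w) ^+ 2)%R] < +oo)%E.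
Hypothesis EX : ('E_P[(fun w => (Z w).1)] = 0)%E.
Hypothesis EY : ('E_P[(fun w => (Z w).2)] = 0)%E.
Hypothesis sigma_gt0 : 0 < sigma.
Hypothesis varY : ('V_P[(fun w => (Z w).2)] = (sigma ^+ 2)%:E)%E.
Hypothesis Zs_iid : iid_copies Z Zs.

Section projected_means_tail.

Context (b : R) (f h : R -> R).
Hypothesis b_gt0 : 0 < b.
Hypothesis f0 : f 0 = 0.
Hypothesis f_incr : forall y z, 0 <= y -> y < z -> z <= b -> f y < f z.
Hypothesis h_inv : forall t, 0 <= t <= f b -> 0 <= h t <= b /\ f (h t) = t.
Hypothesis mh : measurable_fun setT h.

Context (m : nat -> {RV P >-> (R * R)%type}) (t : nat -> {RV P >-> R}).
Hypothesis mt_projected : projected_means Zs b f m t.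
Context (tau : nat -> T -> R).
Hypothesis tauE : tau = (fun n w => t n w) \/ tau = (fun n w => (m n w).2).

Local Notation Pr A := (fine (P A)).

Lemma measurable_tau n : measurable_fun setT (tau n).
Proof.
case: tauE => ->; first exact: measurable_funPT.
exact: measurableT_comp measurable_snd _.
Qed.

Let tau_t e : 0 < e -> exists2 s, 0 < s &
  forall n w, (0 < n)%N -> `|t n w| <= s -> `|tau n w - t n w| <= e * `|t n w|.
Proof.
move=> e0; case: tauE => ->.
  by exists 1 => // n w _ _; rewrite subrr normr0 mulr_ge0// ltW.
have [s s0 hs] := curve_point_ordinate b_gt0 f0 f_incr h_inv mh e0.
exists s => // n w n0; have [Pi _ mt] := mt_projected; have [_ _ ->] := mt n w n0.
exact: hs.
Qed.

Let nearest_t n w : (0 < n)%N -> nearest (f b) (curve_radius b f)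
  (sample_mean (fun i => Zs i) n w).1 (sample_mean (fun i => Zs i) n w).2 (t n w).
Proof.
move=> n0; have [Pi Pi_proj mt] := mt_projected; have [mE tB mq] := mt n w n0.
apply: curve_projection_nearest => //.
by rewrite -mq mE; exact: Pi_proj.
Qed.

Let mean_measurable (phi : R * R -> R) n : measurable_fun setT phi ->
  measurable_fun setT (fun w => n%:R^-1 * \sum_(i < n) phi (Zs i w)).
Proof.
move=> mphi; apply: measurable_funM => //; apply: measurable_sum => i.
exact: measurableT_comp.
Qed.

Context (a : nat -> R).
Hypothesis a_cvgy : a n @[n --> \oo] --> +oo.

(** The curve is symmetric with respect to the horizontal axis, so that the
    lower tail is the upper tail for the reflected observations. *)
Lemma projected_tail u0 l : 0 < u0 ->
  (forall e, 0 < e -> exists u k, [/\ 0 < u < u0, 0 <= k,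
    1 - Phi (k / sigma) <= l + e &
    \forall n \near \oo, k <= Num.sqrt n%:R * h (u / a n)]) ->
  (0 < l -> forall e, 0 < e -> exists u k, [/\ u0 < u, 0 <= k,
    l - e <= 1 - Phi (k / sigma) &
    \forall n \near \oo, Num.sqrt n%:R * h (u / a n) <= k]) ->
  0 <= l ->
  [/\ Pr [set w | u0 <= a n * tau n w] @[n --> \oo] --> l,
      Pr [set w | u0 < a n * tau n w] @[n --> \oo] --> l,
      Pr [set w | a n * tau n w <= - u0] @[n --> \oo] --> l &
      Pr [set w | a n * tau n w < - u0] @[n --> \oo] --> l].
Proof.
move=> u00 up lo l0.
have ix2 := integrable_fst_sqr Zmoment2; have iy2 := integrable_snd_sqr Zmoment2.
have m1 : measurable_fun setT (fst : R * R -> R) by exact: measurable_fst.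
have m2 : measurable_fun setT (snd : R * R -> R) by exact: measurable_snd.
have mN2 : measurable_fun setT (fun z : R * R => - z.2) by exact: measurableT_comp.
have ix : P.-integrable setT (EFin \o (fun w => (Z w).1)).
  by apply: square_integrable ix2; exact: measurableT_comp.
have iy : P.-integrable setT (EFin \o (fun w => (Z w).2)).
  by apply: square_integrable iy2; exact: measurableT_comp.
have iNy : P.-integrable setT (EFin \o (fun w => - (Z w).2)) by exact: integrableN iy.
have iNy2 : P.-integrable setT (EFin \o (fun w => (- (Z w).2) ^+ 2)).
  by under [X in EFin \o X]eq_fun do rewrite sqrrN.
have Ex := expectation_Rintegral EX; have Ey := expectation_Rintegral EY.
have Vy : \int[P]_w ((Z w).2 ^+ 2) = sigma ^+ 2 by exact: centred_variance.
have ENy : \int[P]_w (- (Z w).2) = 0.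
  under eq_Rintegral do rewrite -mulN1r.
  by rewrite RintegralZl// Ey mulr0.
have VNy : \int[P]_w ((- (Z w).2) ^+ 2) = sigma ^+ 2.
  by under eq_Rintegral do rewrite sqrrN.
have tight_x e (e0 : 0 < e) := iid_tight Zs_iid m1 ix ix2 Ex erefl e0.
have tight_y e (e0 : 0 < e) := iid_tight Zs_iid m2 iy iy2 Ey Vy e0.
have tight_Ny e (e0 : 0 < e) := iid_tight Zs_iid mN2 iNy iNy2 ENy VNy e0.
have clt_y k := central_limit (k := k) Zs_iid m2 iy iy2 Ey Vy sigma_gt0 erefl.
have clt_Ny k := central_limit (k := k) Zs_iid mN2 iNy iNy2 ENy VNy sigma_gt0 erefl.
have B0 := increasing_end_gt0 b_gt0 f0 f_incr.
have r0 := curve_radius0 b_gt0 f0 f_incr h_inv.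
have rinc := curve_radius_increment f_incr h_inv mh.
have g0 := inverse_ge0 h_inv.
have gp := inverse_gt0 f0 h_inv.
have gle := inverse_le h_inv.
have [R1 R2] := tail_cvg B0 r0 g0 gp rinc gle a_cvgy
  (fun n => mean_measurable n m1) (fun n => mean_measurable n m2) measurable_tau
  tight_x tight_y clt_y nearest_t tau_t u00 up lo l0.
pose tN n w := - t n w; pose tauN n w := - tau n w.
have mtauN n : measurable_fun setT (tauN n).
  by apply: measurableT_comp => //; exact: measurable_tau.
have nearest_tN n w : (0 < n)%N -> nearest (f b) (curve_radius b f)
    (n%:R^-1 * \sum_(i < n) (Zs i w).1) (n%:R^-1 * \sum_(i < n) - (Zs i w).2)
    (tN n w).
  by move=> n0; rewrite sumrN mulrN; apply: nearest_opp; exact: nearest_t.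
have tau_tN e : 0 < e -> exists2 s, 0 < s & forall n w, (0 < n)%N ->
    `|tN n w| <= s -> `|tauN n w - tN n w| <= e * `|tN n w|.
  move=> /tau_t[s s0 hs]; exists s => // n w n0.
  by rewrite /tN /tauN -opprD !normrN; exact: hs.
have [L1 L2] := tail_cvg B0 r0 g0 gp rinc gle a_cvgy
  (fun n => mean_measurable n m1) (fun n => mean_measurable n mN2) mtauN
  tight_x tight_Ny clt_Ny nearest_tN tau_tN u00 up lo l0.
split=> //.
- rewrite (_ : (fun n => _) = fun n => Pr [set w | u0 <= a n * tauN n w])//.
  by apply/funext => n; congr (fine (P _)); apply/seteqP; split => w /=;
    rewrite /tauN mulrN lerNr.
- rewrite (_ : (fun n => _) = fun n => Pr [set w | u0 < a n * tauN n w])//.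
  by apply/funext => n; congr (fine (P _)); apply/seteqP; split => w /=;
    rewrite /tauN mulrN ltrNr.
Qed.

End projected_means_tail.

(** * The three limit theorems *)

Section power_limit.
Context (b gamma : R).
Hypothesis b_gt0 : 0 < b.
Hypothesis gamma_gt0 : 0 < gamma.
Context (m : nat -> {RV P >-> (R * R)%type}) (t : nat -> {RV P >-> R}).
Hypothesis mt_projected :
  projected_means Zs b (zero_at0 (fun y => y `^ gamma)) m t.
Context (tau : nat -> T -> R).
Hypothesis tauE : tau = (fun n w => t n w) \/ tau = (fun n w => (m n w).2).

Local Notation Pr A := (fine (P A)).
Let V n w : R := n%:R `^ (gamma / 2) * tau n w.

Let mV n : measurable_fun setT (V n).
Proof. by apply: measurable_funM => //; exact: (measurable_tau tauE). Qed.

Let a_cvgy : n%:R `^ (gamma / 2) @[n --> \oo] --> (+oo : set_system R).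
Proof. by apply: cvgy_powR; [rewrite divr_gt0|exact: cvgr_idn]. Qed.

Let law u : R := Phi (u `^ gamma^-1 / sigma).

Let law_continuous (u : R) : 0 < u -> {for u, continuous law}.
Proof.
move=> u0; rewrite /law.
apply: (@continuous_comp _ _ _ (fun v : R => v `^ gamma^-1 / sigma) (@Phi R)).
  by apply: cvgMr_tmp; exact: powR_continuous.
exact: Phi_continuous.
Qed.

Let power_tail (u : R) : 0 < u ->
  Pr [set w | u < V n w] @[n --> \oo] --> 1 - law u /\
  Pr [set w | V n w <= - u] @[n --> \oo] --> 1 - law u.
Proof.
move=> u0.
have slope (v : R) : 0 < v -> \forall n \near \oo,
    Num.sqrt n%:R * ((v / n%:R `^ (gamma / 2)) `^ gamma^-1) = v `^ gamma^-1.
  by move=> v0; near=> n; apply: power_slope => //; near: n; exists 1%N.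
have near_law (e : R) : 0 < e -> \forall v \near u, `|law u - law v| <= e.
  exact: continuous_dist_le (law_continuous u0).
have [] := projected_tail b_gt0
  (power_f0 gamma) (power_incr gamma_gt0) (power_inv b_gt0 gamma_gt0)
  (power_inv_measurable gamma) mt_projected tauE a_cvgy (u0 := u) (l := 1 - law u).
- exact: u0.
- move=> e e0; near u^'- => v.
  have vu : v < u by near: v; exact: nbhs_left_lt.
  have v0 : 0 < v by near: v; exact: nbhs_left_gt.
  exists v, (v `^ gamma^-1); split; first by rewrite v0.
  + exact: powR_ge0.
  + rewrite -/(law v) -addrA lerD2l -lerBlDl opprK addrC.
    have : `|law u - law v| <= e.
      by near: v; apply: cvg_within; exact: near_law.
    by rewrite ler_norml => /andP[].
  + by have := slope v v0; apply: filterS => n ->.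
- move=> _ e e0; near u^'+ => v.
  have uv : u < v by near: v; exact: nbhs_right_gt.
  have v0 := lt_trans u0 uv.
  exists v, (v `^ gamma^-1); split=> //.
  + exact: powR_ge0.
  + rewrite -/(law v) -addrA lerD2l -lerBrDl opprK addrC.
    have : `|law u - law v| <= e.
      by near: v; apply: cvg_within; exact: near_law.
    by rewrite ler_norml => /andP[].
  + by have := slope v v0; apply: filterS => n ->.
- by rewrite subr_ge0 Phi_le1.
by [].
Unshelve. all: by end_near. Qed.

(** Each point [u] has the slope [u `^ gamma^-1], whatever the sample size:
    the distribution functions converge everywhere. *)
Lemma power_limit : exists (d' : measure_display) (T' : measurableType d')
  (P' : probability T' R) (W : {RV P' >-> R}),
  (forall s : R, P' [set w | W w <= s]
    = (Phi (Num.sg s * `|s| `^ (1 / gamma) / sigma))%:E) /\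
  cvg_in_distribution P V W.
Proof.
pose W0 : measurableTypeR R -> R := fun x => spow gamma (sigma * x).
pose K s : R := Num.sg s * `|s| `^ (1 / gamma) / sigma.
have W0le s : [set x | W0 x <= s] = `]-oo, K s]%classic.
  apply/seteqP; split => x; rewrite /= in_itv/= /W0 spow_le// /K /spow div1r.
    by rewrite ler_pdivlMr// mulrC.
  by rewrite ler_pdivlMr// mulrC.
have mW0 : measurable_fun setT W0.
  apply: (@nondecreasing_measurable R setT W0) => //.
  move=> x y xy.
  by apply: (ltW_homo (spow_homo gamma_gt0)); rewrite ler_pM2l.
exists _, (measurableTypeR R), (normal_prob (0 : R) 1), (@rv_of R _ _ (measurableTypeR R) R _ _ mW0).
have WE s : normal_prob (0 : R) 1 [set w | W0 w <= s] = (Phi (K s))%:E.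
  by rewrite W0le PhiE.
split; first exact: WE.
move=> s _; rewrite [X in _ --> X](_ : _ = (Phi (K s))%:E); last exact: WE.
apply: cvg_probability; first by move=> n; exact: measurable_le.
have KE (u : R) : 0 < u -> Phi (K u) = law u.
  by move=> u0; rewrite /law -div1r /K (gtr0_sg u0) mul1r (gtr0_norm u0).
have [s0|s0|s0] := ltgtP 0 s.
- have [up _] := power_tail s0; rewrite KE// -[law s](subKr 1).
  exact: (cvg_le_of_gt mV up).
- have Ns0 : 0 < - s by rewrite oppr_gt0.
  have [_] := power_tail Ns0; rewrite opprK.
  by rewrite -KE// -PhiN /K sgrN normrN mulNr mulNr opprK.
- rewrite -s0 /K sgr0 mul0r mul0r Phi0; apply: cvg_le0_half => // e e0.
  have near_Phi : \forall y \near (0 : R), `|Phi 0 - Phi y| <= e.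
    exact: continuous_dist_le (@Phi_continuous R 0) e0.
  near ((0 : R)^'+) => y.
  have y0 : 0 < y by [].
  have Phi_y : Phi y <= 1 / 2 + e.
    have : `|Phi 0 - Phi y| <= e by near: y; apply: cvg_within; exact: near_Phi.
    by rewrite Phi0 ler_norml => /andP[]; lra.
  have sy0 : 0 < sigma * y by rewrite mulr_gt0.
  pose u := (sigma * y) `^ gamma.
  have u0 : 0 < u by rewrite powR_gt0.
  have lawE : law u = Phi y.
    rewrite /law /u -powRrM mulfV ?gt_eqF// powRr1 ?ltW//.
    by rewrite mulrAC mulfV ?gt_eqF// mul1r.
  have [up lo] := power_tail u0.
  by exists u, (1 - law u); split=> //; rewrite lawE; lra.
Unshelve. all: by end_near. Qed.

End power_limit.

Section logarithmic_limit.
Context (b gamma : R).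
Hypothesis b_gt0 : 0 < b.
Hypothesis b_lt1 : b < 1.
Hypothesis gamma_gt0 : 0 < gamma.
Context (m : nat -> {RV P >-> (R * R)%type}) (t : nat -> {RV P >-> R}).
Hypothesis mt_projected :
  projected_means Zs b (zero_at0 (fun y => (- ln y) `^ (- gamma))) m t.
Context (tau : nat -> T -> R).
Hypothesis tauE : tau = (fun n w => t n w) \/ tau = (fun n w => (m n w).2).

Local Notation Pr A := (fine (P A)).
Let V n w : R := (1 / 2 * ln n%:R) `^ gamma * tau n w.

Let mV n : measurable_fun setT (V n).
Proof. by apply: measurable_funM => //; exact: (measurable_tau tauE). Qed.

Let L_cvgy : 1 / 2 * ln n%:R @[n --> \oo] --> (+oo : set_system R).
Proof. by apply: cvgy_Mpos; [rewrite divr_gt0|exact: cvgy_lnn]. Qed.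

Let a_cvgy : (1 / 2 * ln n%:R) `^ gamma @[n --> \oo] --> (+oo : set_system R).
Proof. exact: cvgy_powR. Qed.

(** The exponent of the slope tends to plus or minus infinity according to the
    position of [u] with respect to 1. *)
Let slope_large (u k : R) : 1 < u -> \forall n \near \oo,
  k <= Num.sqrt n%:R * logarithmic_inverse gamma (u / (1 / 2 * ln n%:R) `^ gamma).
Proof.
move=> u1; have u0 : 0 < u := lt_trans ltr01 u1.
pose c : R := 1 - u `^ (- 1 / gamma).
have c0 : 0 < c.
  have g0 : 0 < gamma^-1 by rewrite invr_gt0.
  by rewrite subr_gt0 mulN1r; have := powR_gt0_decr g0 ltr01 u1; rewrite powR1.
near=> n; rewrite logarithmic_slope//; last by near: n; exists 2%N.
rewrite mulrC -/c; near: n.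
by have /cvgryPge := cvgy_expR (cvgy_Mpos c0 L_cvgy); exact.
Unshelve. all: by end_near. Qed.

Let slope_small (u k : R) : 0 < u -> u < 1 -> 0 < k -> \forall n \near \oo,
  Num.sqrt n%:R * logarithmic_inverse gamma (u / (1 / 2 * ln n%:R) `^ gamma) <= k.
Proof.
move=> u0 u1 k0; pose c : R := u `^ (- 1 / gamma) - 1.
have c0 : 0 < c.
  have g0 : 0 < gamma^-1 by rewrite invr_gt0.
  by rewrite subr_gt0 mulN1r; have := powR_gt0_decr g0 u0 u1; rewrite powR1.
near=> n; rewrite logarithmic_slope//; last by near: n; exists 2%N.
rewrite -opprB mulrN -/c mulrC expRN -[leRHS]invrK lef_pV2 ?posrE ?invr_gt0 ?expR_gt0//.
near: n.
by have /cvgryPge := cvgy_expR (cvgy_Mpos c0 L_cvgy); exact.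
Unshelve. all: by end_near. Qed.

Let tail := projected_tail b_gt0
  (logarithmic_f0 gamma) (logarithmic_incr b_lt1 gamma_gt0)
  (logarithmic_inv b_gt0 b_lt1 gamma_gt0)
  (logarithmic_inv_measurable gamma) mt_projected tauE a_cvgy.

Let tail_large (u : R) : 1 < u ->
  Pr [set w | u < V n w] @[n --> \oo] --> (0 : R) /\
  Pr [set w | V n w <= - u] @[n --> \oo] --> (0 : R).
Proof.
move=> u1.
have [] := tail (u0 := u) (l := 0).
- exact: lt_trans u1.
- move=> e e0; have [y y0 hy] := Phi_tail e0.
  exists ((1 + u) / 2), (y * sigma); split; [lra| |by rewrite mulfK ?gt_eqF ?add0r|].
    by rewrite mulr_ge0// ltW.
  by apply: slope_large; lra.
- by rewrite ltxx.
- exact: lexx.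
by [].
Qed.

Let tail_small (u : R) : 0 < u -> u < 1 ->
  Pr [set w | u < V n w] @[n --> \oo] --> (1 / 2 : R) /\
  Pr [set w | V n w <= - u] @[n --> \oo] --> (1 / 2 : R).
Proof.
move=> u0 u1.
have [] := tail (u0 := u) (l := 1 / 2).
- exact: u0.
- move=> e e0; exists (u / 2), 0; split; [lra|exact: lexx| |].
    by rewrite mul0r Phi0; lra.
  by apply: nearW => n; rewrite mulr_ge0 ?sqrtr_ge0// /logarithmic_inverse;
    case: ifP => // _; exact: expR_ge0.
- move=> _ e e0.
  have near_Phi : \forall y \near (0 : R), `|Phi 0 - Phi y| <= e.
    exact: continuous_dist_le (@Phi_continuous R 0) e0.
  near ((0 : R)^'+) => y.
  have y0 : 0 < y by [].
  have Phi_y : Phi y <= 1 / 2 + e.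
    have : `|Phi 0 - Phi y| <= e by near: y; apply: cvg_within; exact: near_Phi.
    by rewrite Phi0 ler_norml => /andP[]; lra.
  exists ((1 + u) / 2), (y * sigma); split; [lra| | |].
  + by rewrite mulr_ge0// ltW.
  + by rewrite mulfK ?gt_eqF//; lra.
  + by apply: slope_small; [lra|lra|rewrite mulr_gt0].
- by rewrite divr_ge0.
by [].
Unshelve. all: by end_near. Qed.

Lemma logarithmic_limit : exists (d' : measure_display) (T' : measurableType d')
  (P' : probability T' R) (W : {RV P' >-> R}),
  [/\ P' [set w | W w = 1] = (1 / 2)%:E,
      P' [set w | W w = - 1] = (1 / 2)%:E &
      cvg_in_distribution P V W].
Proof.
pose W0 : measurableTypeR R -> R := fun x => if x <= 0 then - 1 else 1.
have mW0 : measurable_fun setT W0.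
  apply: (@nondecreasing_measurable R setT W0) => //.
  move=> x y xy; rewrite /W0; have [x0|x0] := leP x 0; have [y0|y0] := leP y 0; lra.
exists _, (measurableTypeR R), (normal_prob (0 : R) 1), (@rv_of R _ _ (measurableTypeR R) R _ _ mW0).
have W_N1 : [set w | W0 w = - 1] = `]-oo, 0]%classic.
  by apply/seteqP; split => x; rewrite /= in_itv/= /W0; case: ifP => // _; lra.
have W_1 : [set w | W0 w = 1] = ~` `]-oo, 0]%classic.
  apply/seteqP; split => x; rewrite /= in_itv/= /W0; case: ifP => //; lra.
have W_lt s : s < - 1 -> normal_prob (0 : R) 1 [set w | W0 w <= s] = 0%E.
  move=> s1; rewrite (_ : [set _ | _] = set0) ?measure0//.
  by apply/seteqP; split => x //=; rewrite /W0; case: ifP => _; lra.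
have W_mid s : - 1 <= s -> s < 1 ->
    normal_prob (0 : R) 1 [set w | W0 w <= s] = (1 / 2)%:E.
  move=> s1 s2; rewrite (_ : [set _ | _] = `]-oo, 0]%classic) ?PhiE ?Phi0//.
  by apply/seteqP; split => x; rewrite /= in_itv/= /W0; case: ifP => // _; lra.
have W_gt s : 1 <= s -> normal_prob (0 : R) 1 [set w | W0 w <= s] = 1%E.
  move=> s1; rewrite (_ : [set _ | _] = setT) ?probability_setT//.
  by apply/seteqP; split => x //= _; rewrite /W0; case: ifP => _; lra.
split.
- apply: (@eq_trans _ _ (normal_prob (0 : R) 1 [set w | W0 w = 1])) => //.
  transitivity (1 - normal_prob (0 : R) 1 `]-oo, 0%R])%E.
    by rewrite W_1; exact: probability_setC.
  by rewrite PhiE Phi0 -EFinB; congr EFin; lra.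
- apply: (@eq_trans _ _ (normal_prob (0 : R) 1 [set w | W0 w = - 1])) => //.
  by rewrite W_N1 PhiE Phi0.
pose W := @rv_of R _ _ (measurableTypeR R) R (normal_prob (0 : R) 1) _ mW0.
have mVle n s : measurable [set w | V n w <= s] by exact: measurable_le.
have cdfE s : cdf W s = normal_prob (0 : R) 1 [set w | W0 w <= s] by [].
(* the atoms 1 and -1 of the limit are not among the points [s] to consider *)
have jump (s x y : R) : x < y -> cdf W s = y%:E ->
    (\forall v \near s^'-, cdf W v = x%:E) -> ~ {for s, continuous (cdf W)}.
  move=> /lt_eqF/eqP xy Ws near_x /cvg_at_left_filter Wcont; apply: xy.
  have Wx : cdf W v @[v --> s^'-] --> x%:E by exact: cvg_near_cst.
  apply: EFin_inj; rewrite -Ws.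
  exact: (cvg_unique _ Wx Wcont).
move=> s s_cont.
have [s1|s1|s1] := ltgtP s (- 1).
- rewrite cdfE W_lt//; apply: (cvg_probability (l := 0)) => //.
  have Ns1 : 1 < - s by lra.
  by have [_] := tail_large Ns1; rewrite opprK.
- have [s2|s2|s2] := ltgtP s 1.
  + rewrite cdfE W_mid ?(ltW s1)//; apply: cvg_probability => //.
    have [s0|s0|s0] := ltgtP 0 s.
    * have [up _] := tail_small s0 s2.
      by rewrite (_ : 1 / 2 = 1 - 1 / 2); [exact: (cvg_le_of_gt mV up)|lra].
    * have [Ns0 Ns1] : 0 < - s /\ - s < 1 by split; lra.
      by have [_] := tail_small Ns0 Ns1; rewrite opprK.
    * rewrite -s0; apply: cvg_le0_half => // e e0.
      have [h0 h1] : (0 : R) < 1 / 2 /\ (1 / 2 : R) < 1 by split; lra.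
      have [up lo] := tail_small h0 h1.
      by exists (1 / 2), (1 / 2); split=> //; lra.
  + rewrite cdfE W_gt ?(ltW s2)//; apply: (cvg_probability (l := 1)) => //.
    by have [up _] := tail_large s2; rewrite -[1]subr0; exact: (cvg_le_of_gt mV up).
  + exfalso; apply: (jump s (1 / 2) 1 _ _ _ s_cont); first by lra.
      by rewrite cdfE W_gt// s2.
    near=> v; rewrite cdfE W_mid//; first by near: v; exact: nbhs_left_ge.
    by rewrite -s2; near: v; exact: nbhs_left_lt.
- exfalso; apply: (jump s 0 (1 / 2) _ _ _ s_cont); first by lra.
    by rewrite cdfE W_mid// s1//; lra.
  near=> v; rewrite cdfE W_lt// -s1.
  by near: v; exact: nbhs_left_lt.
Unshelve. all: by end_near. Qed.

End logarithmic_limit.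

Section exponential_limit.
Context (b gamma : R).
Hypothesis b_gt0 : 0 < b.
Hypothesis gamma_gt0 : 0 < gamma.
Context (m : nat -> {RV P >-> (R * R)%type}) (t : nat -> {RV P >-> R}).
Hypothesis mt_projected :
  projected_means Zs b (zero_at0 (fun y => expR (- y `^ (- gamma)))) m t.
Context (tau : nat -> T -> R).
Hypothesis tauE : tau = (fun n w => t n w) \/ tau = (fun n w => (m n w).2).
Context (c : R).
Hypothesis c_gt0 : 0 < c.

Local Notation Pr A := (fine (P A)).
Let U n w : R := expR ((Num.sqrt n%:R / c) `^ gamma) * tau n w.
Let p : R := Phi (c / sigma).

Let mU n : measurable_fun setT (U n).
Proof. by apply: measurable_funM => //; exact: (measurable_tau tauE). Qed.

Let a_cvgy : expR ((Num.sqrt n%:R / c) `^ gamma) @[n --> \oo]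
  --> (+oo : set_system R).
Proof.
apply: cvgy_expR; apply: cvgy_powR => //.
rewrite (_ : (fun n => _) = fun n => c^-1 * Num.sqrt n%:R).
  by apply: cvgy_Mpos; [rewrite invr_gt0|exact: cvgy_sqrtn].
by apply/funext => n; rewrite mulrC.
Qed.

Let exponential_tail (u : R) : 0 < u ->
  [/\ Pr [set w | u <= U n w] @[n --> \oo] --> 1 - p,
      Pr [set w | u < U n w] @[n --> \oo] --> 1 - p,
      Pr [set w | U n w <= - u] @[n --> \oo] --> 1 - p &
      Pr [set w | U n w < - u] @[n --> \oo] --> 1 - p].
Proof.
move=> u0.
pose law k : R := Phi (k / sigma).
have near_law (e : R) : 0 < e -> \forall k \near c, `|law c - law k| <= e.
  apply: continuous_dist_le; rewrite /law.
  apply: (@continuous_comp _ _ _ (fun k : R => k / sigma) (@Phi R)).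
    by apply: cvgMr_tmp; exact: cvg_id.
  exact: Phi_continuous.
have slope (v : R) : 0 < v -> Num.sqrt n%:R *
    (ln (v / expR ((Num.sqrt n%:R / c) `^ gamma))^-1) `^ (- 1 / gamma)
    @[n --> \oo] --> c.
  by move=> v0; exact: exponential_slope.
apply: (projected_tail b_gt0
  (exponential_f0 gamma) (exponential_incr gamma_gt0)
  (exponential_inv b_gt0 gamma_gt0)
  (exponential_inv_measurable gamma) mt_projected tauE a_cvgy) => //.
- move=> e e0; near c^'- => k.
  have kc : k < c by near: k; exact: nbhs_left_lt.
  have k0 : 0 < k by near: k; exact: nbhs_left_gt.
  exists (u / 2), k; split; [lra|exact: ltW| |].
  + rewrite -/(law k) /p -/(law c) -addrA lerD2l -lerBlDl opprK addrC.
    have : `|law c - law k| <= e by near: k; apply: cvg_within; exact: near_law.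
    by rewrite ler_norml => /andP[].
  + have u20 : 0 < u / 2 by rewrite divr_gt0.
    exact: (cvgr_ge _ (slope _ u20)).
- move=> _ e e0; near c^'+ => k.
  have ck : c < k by near: k; exact: nbhs_right_gt.
  exists (2 * u), k; split; [lra|exact: ltW (lt_trans c_gt0 ck)| |].
  + rewrite -/(law k) /p -/(law c) -addrA lerD2l -lerBrDl opprK addrC.
    have : `|law c - law k| <= e by near: k; apply: cvg_within; exact: near_law.
    by rewrite ler_norml => /andP[].
  + have u20 : 0 < 2 * u by rewrite mulr_gt0.
    exact: (cvgr_le _ (slope _ u20)).
- by rewrite subr_ge0 Phi_le1.
Unshelve. all: by end_near. Qed.

(** The limits do not depend on [u]: the mass [2 * p - 1] collapses to 0 and
    the remaining mass escapes to infinity on both sides. *)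
Lemma exponential_limit (u : R) : 0 < u ->
  [/\ P [set w | u <= U n w] @[n --> \oo] --> (1 - p)%:E,
      P [set w | U n w <= - u] @[n --> \oo] --> (1 - p)%:E &
      P [set w | `|U n w| <= u] @[n --> \oo] --> (2 * p - 1)%:E].
Proof.
move=> u0; have [ge_u gt_u le_Nu lt_Nu] := exponential_tail u0.
have m_ge n : measurable [set w | u <= U n w] by exact: measurable_ge.
have m_gt n : measurable [set w | u < U n w] by exact: measurable_gt.
have m_lt n : measurable [set w | U n w < - u] by exact: measurable_lt.
split.
- exact: cvg_probability.
- by apply: cvg_probability => // n; exact: measurable_le.
have normE n : [set w | `|U n w| <= u] =
    ~` ([set w | u < U n w] `|` [set w | U n w < - u]).
  apply/seteqP; split => w /=; rewrite ler_norml.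
    by case/andP=> h1 h2; case; rewrite ltNge ?h1 ?h2.
  by move=> /not_orP[] /negP; rewrite -leNgt => -> /negP; rewrite -leNgt => ->.
have m_tails n : measurable ([set w | u < U n w] `|` [set w | U n w < - u]).
  exact: measurableU.
apply: cvg_probability; first by move=> n; rewrite normE; exact: measurableC.
rewrite (_ : (fun n => _) = fun n =>
    1 - (Pr [set w | u < U n w] + Pr [set w | U n w < - u])); last first.
  apply/funext => n; rewrite normE fine_probabilityC//; congr (1 - _).
  rewrite measureU// ?fineD ?fin_num_measure//.
  apply/seteqP; split => w //= [] h1 h2; lra.
rewrite (_ : 2 * p - 1 = 1 - ((1 - p) + (1 - p))).
  by apply: cvgB; [exact: cvg_cst|exact: cvgD].
by rewrite opprD opprB; ring.
Qed.

End exponential_limit.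

End projected_means.

Theorem corollary9 (R : realType) (d : measure_display) (T : measurableType d)
    (P : probability T R) (Z : {RV P >-> (R * R)%type})
    (Zs : nat -> {RV P >-> (R * R)%type}) (sigma : R)
    (Zmoment2 : ('E_P[(fun w => enorm (Z w) ^+ 2)%R] < +oo)%E)
    (EX : ('E_P[(fun w => (Z w).1)] = 0)%E)
    (EY : ('E_P[(fun w => (Z w).2)] = 0)%E)
    (sigma_gt0 : 0 < sigma)
    (varY : ('V_P[(fun w => (Z w).2)] = (sigma ^+ 2)%:E)%E)
    (Zs_iid : iid_copies Z Zs) :
  [/\ (* (i) *)
      forall b gamma : R, 0 < b -> 0 < gamma ->
      let f := zero_at0 (fun y : R => y `^ gamma) in
      (forall t, t \in `[0, f b] ->
        curve_radius b f t
        = 1 + gamma / (1 + gamma) * t `^ ((1 + gamma) / gamma)) /\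
      (forall (m : nat -> {RV P >-> (R * R)%type}) (t : nat -> {RV P >-> R}),
        projected_means Zs b f m t ->
        forall tau : nat -> T -> R,
          tau = (fun n w => t n w) \/ tau = (fun n w => (m n w).2) ->
        exists (d' : measure_display) (T' : measurableType d')
          (P' : probability T' R) (W : {RV P' >-> R}),
          (forall s : R, P' [set w | W w <= s]
            = (Phi (Num.sg s * `|s| `^ (1 / gamma) / sigma))%:E) /\
          cvg_in_distribution P
            (fun n w => n%:R `^ (gamma / 2) * tau n w) W),
      (* (ii) *)
      forall b gamma : R, 0 < b < 1 -> 0 < gamma ->
      let f := zero_at0 (fun y : R => (- ln y) `^ (- gamma)) in
      (forall t, t \in `[0, f b] ->
        curve_radius b f t
        = 1 + \int[lebesgue_measure]_(x in `[0, t])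
                expR (- x `^ (- 1 / gamma))) /\
      (forall (m : nat -> {RV P >-> (R * R)%type}) (t : nat -> {RV P >-> R}),
        projected_means Zs b f m t ->
        forall tau : nat -> T -> R,
          tau = (fun n w => t n w) \/ tau = (fun n w => (m n w).2) ->
        exists (d' : measure_display) (T' : measurableType d')
          (P' : probability T' R) (W : {RV P' >-> R}),
          [/\ P' [set w | W w = 1] = (1 / 2)%:E,
              P' [set w | W w = - 1] = (1 / 2)%:E &
              cvg_in_distribution P
                (fun n w => (1 / 2 * ln n%:R) `^ gamma * tau n w) W])
    & (* (iii) *)
      forall b gamma : R, 0 < b -> 0 < gamma ->
      let f := zero_at0 (fun y : R => expR (- y `^ (- gamma))) in
      (forall t, t \in `[0, f b] ->
        curve_radius b f t
        = 1 + \int[lebesgue_measure]_(x in `[0, t])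
                (ln x^-1) `^ (- 1 / gamma)) /\
      (forall (m : nat -> {RV P >-> (R * R)%type}) (t : nat -> {RV P >-> R}),
        projected_means Zs b f m t ->
        forall tau : nat -> T -> R,
          tau = (fun n w => t n w) \/ tau = (fun n w => (m n w).2) ->
        forall c : R, 0 < c ->
        let U := fun (n : nat) (w : T) =>
          expR ((Num.sqrt n%:R / c) `^ gamma) * tau n w in
        let p := Phi (c / sigma) in
        forall u : R, 0 < u ->
          [/\ P [set w | u <= U n w] @[n --> \oo] --> (1 - p)%:E,
              P [set w | U n w <= - u] @[n --> \oo] --> (1 - p)%:E &
              P [set w | `|U n w| <= u] @[n --> \oo] --> (2 * p - 1)%:E])].
Proof.
split=> b gamma.
- move=> b0 gamma0 f; split=> [t|m t mt tau tauE]; first exact: power_radius.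
  exact: (power_limit Zmoment2 EX EY sigma_gt0 varY Zs_iid b0 gamma0 mt tauE).
- case/andP=> b0 b1 gamma0 f; split=> [t|m t mt tau tauE].
    exact: logarithmic_radius.
  exact: (logarithmic_limit Zmoment2 EX EY sigma_gt0 varY Zs_iid b0 b1 gamma0
    mt tauE).
- move=> b0 gamma0 f; split=> [t|m t mt tau tauE c c0 U p u].
    exact: exponential_radius.
  exact: (exponential_limit Zmoment2 EX EY sigma_gt0 varY Zs_iid b0 gamma0
    mt tauE c0).
Qed.
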